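(* Consider the discrete-time prediction market game described in the context, with the following additional structure: there is a stationary ergodic Markov sequence $s=(s_t)_{t\ge0}$, adapted to the filtration, with values in a measurable space $\mathcal{S}$, and a non-random measurable function $X:\mathcal{S}\to\Delta^N$ with $X_t=X(s_t)$; moreover, the components $X_t^1,\dots,X_t^N$ are not conditionally linearly dependent, i.e. any non-trivial linear combination of them with $\sigma(s_{t-1})$-measurable coefficients is not a null random variable. Let $\mu(s)=\mathrm{E}(X_{t+1}\mid s_t=s)$. Consider a strategy profile $\Sigma=(\sigma^1,\dots,\sigma^M)$ in which every agent $m$ uses a strategy $\sigma^m=(\nu^m,\lambda^m)$ with $\nu_t^m=\nu^m(s_t)$, $\lambda_t^m=\lambda^m(s_t)$ for non-random functions $\nu^m,\lambda^m$, and such that the components $\lambda_t^{mn}$ and $\nu_t^m$ are bounded away from zero (uniformly in $t$, $\omega$). Suppose $\lambda^1(s)=\mu(s)$. Then $\lim_{t\to\infty}W_t^m=0$ a.s. for every agent $m$ such that $\mathrm{P}(\lambda^m(s_t)\ne\mu(s_t))>0$.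
   Context: Let $(\Omega,\mathcal{F},\mathrm{P})$ be a probability space with a discrete-time filtration $(\mathcal{F}_t)_{t\ge0}$. Let $\Delta^N=\{x\in\mathbb{R}_+^N: x^1+\dots+x^N=1\}$. Let $X=(X_t)_{t\ge1}$ be an adapted sequence of random vectors with values in $\Delta^N$, and assume there is a constant $\epsilon>0$ such that $\mathrm{E}(X_{t+1}^n\mid\mathcal{F}_t)\ge\epsilon$ for all $t\ge0$ and $n=1,\dots,N$. There are $M$ agents with strictly positive non-random initial wealths $W_0^m$. A strategy is a pair $\sigma=(\nu,\lambda)$ where $\nu=(\nu_t)_{t\ge0}$ takes values in $[0,1]$, $\lambda=(\lambda_t)_{t\ge0}$ takes values in $\Delta^N$, and $\nu_t,\lambda_t$ are $\mathcal{F}_t$-measurable. Wealth evolves by $$W_{t+1}^m=\sum_{k=1}^M\nu_t^kW_t^k\cdot\sum_{n=1}^N\frac{\nu_t^m\lambda_t^{mn}W_t^m}{\sum_{k=1}^M\nu_t^k\lambda_t^{kn}W_t^k}X_{t+1}^n+(1-\nu_t^m)W_t^m.$$ *)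

(* Defs.v *)
From HB Require Import structures.
From mathcomp Require Import all_boot all_order all_algebra.
From mathcomp Require Import all_classical all_reals all_analysis.
Set Implicit Arguments. Unset Strict Implicit. Unset Printing Implicit Defensive.
Import Order.TTheory GRing.Theory Num.Theory.
Import numFieldNormedType.Exports.
Local Open Scope classical_set_scope.
Local Open Scope ring_scope.

Section Defs.
Context {R : realType}.

Definition in_simplex (N : nat) (x : 'I_N -> R) :=
  (forall n, 0 <= x n) /\ \sum_(n < N) x n = 1.

Definition G_measurable {T : Type} (G : set (set T)) (f : T -> R) :=
  forall B : set R, measurable B -> G (f @^-1` B).

Definition sigma_of {T : Type} {dS} {S : measurableType dS} (Y : T -> S)
  : set (set T) := [set Y @^-1` B | B in measurable].

Definition is_filtration {d} {Omega : measurableType d}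
  (F : nat -> set (set Omega)) :=
  (forall t, sigma_algebra setT (F t)) /\
  (forall t, F t `<=` measurable) /\
  (forall t u, (t <= u)%N -> F t `<=` F u).

Definition cond_exp_version {d} {Omega : measurableType d}
  (P : probability Omega R) (G : set (set Omega)) (X Y : Omega -> R) :=
  P.-integrable setT (EFin \o X) /\
  G_measurable G Y /\ P.-integrable setT (EFin \o Y) /\
  (forall A, G A -> (\int[P]_(w in A) (Y w)%:E = \int[P]_(w in A) (X w)%:E)%E).

Definition markov_wrt {d} {Omega : measurableType d} {dS} {S : measurableType dS}
  (P : probability Omega R) (F : nat -> set (set Omega)) (s : nat -> Omega -> S) :=
  forall t (B : set S), measurable B ->
    exists g : S -> R, measurable_fun setT g /\
      cond_exp_version P (F t) (\1_(s t.+1 @^-1` B)) (g \o s t).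

Definition stationary {d} {Omega : measurableType d} {dS} {S : measurableType dS}
  (P : probability Omega R) (s : nat -> Omega -> S) :=
  forall (k t : nat) (B : nat -> set S), (forall i, measurable (B i)) ->
    P [set w | forall i, (i <= k)%N -> B i (s (t + i)%N w)] =
    P [set w | forall i, (i <= k)%N -> B i (s i w)].

Definition seq_measurable {dS} {S : measurableType dS} : set (set (nat -> S)) :=
  smallest (sigma_algebra setT)
    [set A | exists (i : nat) (B : set S), measurable B /\ A = [set x | B (x i)]].

Definition shift {S : Type} (x : nat -> S) : nat -> S := fun t => x t.+1.

Definition ergodic {d} {Omega : measurableType d} {dS} {S : measurableType dS}
  (P : probability Omega R) (s : nat -> Omega -> S) :=
  forall A : set (nat -> S), seq_measurable A -> shift @^-1` A = A ->
    P ((fun w t => s t w) @^-1` A) = 0%E \/ P ((fun w t => s t w) @^-1` A) = 1%E.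

Definition wealth_step (M N : nat) (nu : 'I_M -> R) (lam : 'I_M -> 'I_N -> R)
  (x : 'I_N -> R) (W : 'I_M -> R) : 'I_M -> R := fun m =>
  (\sum_(k < M) nu k * W k) *
  (\sum_(n < N) (nu m * lam m n * W m / (\sum_(k < M) nu k * lam k n * W k)) * x n)
  + (1 - nu m) * W m.

Fixpoint wealth (M N : nat) (W0 : 'I_M -> R) (nu : nat -> 'I_M -> R)
  (lam : nat -> 'I_M -> 'I_N -> R) (X : nat -> 'I_N -> R) (t : nat) : 'I_M -> R :=
  match t with
  | 0 => W0
  | t'.+1 => wealth_step (nu t') (lam t') (X t'.+1) (wealth W0 nu lam X t')
  end.

End Defs.

(* Main.v *)
Require Import Defs.
From HB Require Import structures.
From mathcomp Require Import all_boot all_order all_algebra.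
From mathcomp Require Import ring lra.
From mathcomp Require Import all_classical all_reals all_analysis.
From mathcomp Require Import measurable_realfun.
Set Implicit Arguments. Unset Strict Implicit. Unset Printing Implicit Defensive.
Import Order.TTheory GRing.Theory Num.Theory.
Import numFieldNormedType.Exports.
Local Open Scope classical_set_scope.
Local Open Scope ring_scope.

(** The logarithm of agent 1's wealth is bounded above, and by concavity its
    expected one-step growth dominates a multiple of the expected squared
    distance between [mu] and the market prices. These distances are therefore
    summable in expectation, and the prices converge to [mu] almost surely.
    Up to an error tending to [0], the log-wealth of agent [m] then grows by
    [log_growth m (s t) (s t.+1)], whose expectation is negative when [lam m]
    differs from [mu]: the growth factor has mean one, and it is not constant
    because the outcomes are linearly independent. Only the one-sided half of
    the ergodic theorem is needed: partial sums of a stationary ergodic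
    sequence with negative mean are almost surely bounded above. *)

(** The actual prices depend on the wealth of all agents, hence on the whole past, so the growth
    factors at these prices need not form a stationary sequence and no ergodic argument applies to
    them directly. With [mu] in place of the prices the factor depends only on two consecutive
    states. The error of this replacement need only tend to 0, without any rate: a negative mean
    leaves a linear drift that absorbs it. The tangent bound [ln u <= u - 1] alone would only make
    the drift of agent [m1] nonnegative. The quadratic term of [ln_le_quadratic] makes this drift
    quantitative, and it also gives the strict sign for the competitor. A further obstacle is that
    [mu] is a conditional mean given [s t], while the prices are measurable only for [F t]. The
    Markov property bridges the two sigma-algebras. *)

Local Notation shift := Defs.shift.

(** * The space of trajectories and its sigma-algebra *)

Section CoordinateCylinders.
Context {dS : measure_display} (S : measurableType dS).

(** The generators of [seq_measurable], named so that measurability in [path_space S] is convertible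
    with it and [ergodic] applies directly to measurable sets of paths. *)
Definition coordinate_cylinders : set (set (nat -> S)) :=
  [set A | exists (i : nat) (B : set S), measurable B /\ A = [set x | B (x i)]].

End CoordinateCylinders.

Notation path_space S := (g_sigma_algebraType (@coordinate_cylinders _ S)).

Section PathSpace.
Context {dS : measure_display} (S : measurableType dS).

(** The sets on which [stationary] speaks. Unlike the single-coordinate cylinders they are closed
    under intersection, as the uniqueness theorem for measures requires. *)
Definition box_cylinders : set (set (path_space S)) :=
  [set A | exists (k : nat) (B : nat -> set S), (forall i, measurable (B i)) /\
     A = [set x | forall i, (i <= k)%N -> B i (x i)]].

Lemma measurable_coordinate i : measurable_fun setT (fun x : path_space S => x i).
Proof.
move=> _ B mB; rewrite setTI; apply: sub_sigma_algebra.
by exists i, B.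
Qed.

Lemma box_cylinders_measurable : box_cylinders `<=` measurable.
Proof.
move=> A [k [B [mB ->]]].
rewrite (_ : [set x | _] = \bigcap_(i in [set i | (i <= k)%N])
    ((fun x : path_space S => x i) @^-1` B i)); last first.
  by apply/seteqP; split => x /= h i; exact: h.
apply: bigcap_measurableType => i _.
by rewrite -[X in measurable X]setTI; exact: measurable_coordinate.
Qed.

Lemma setI_closed_box_cylinders : setI_closed box_cylinders.
Proof.
move=> A A' [k [B [mB ->]]] [k' [B' [mB' ->]]].
(* Each box is padded with [setT] beyond its own length. *)
exists (maxn k k'), (fun i => (if (i <= k)%N then B i else setT) `&`
                         (if (i <= k')%N then B' i else setT)); split.
  by move=> i; apply: measurableI; case: ifP.
apply/seteqP; split => x /=.
  by move=> [h h'] i _; split; case: ifP => // *; [exact: h|exact: h'].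
move=> h; split => i ik.
- by have := h i; rewrite leq_max ik /= => /(_ isT) [].
- by have := h i; rewrite leq_max ik orbT /= => /(_ isT) [].
Qed.

Lemma path_space_measurableE : @measurable _ (path_space S) = <<s box_cylinders >>.
Proof.
apply/seteqP; split.
  apply: smallest_sub; first exact: smallest_sigma_algebra.
  move=> A [i [B [mB ->]]]; apply: sub_sigma_algebra.
  exists i, (fun j => if j == i then B else setT); split.
    by move=> j; case: ifP.
  apply/seteqP; split => x /=; first by move=> h j _; case: eqP => [->|].
  by move=> /(_ i (leqnn _)); rewrite eqxx.
apply: smallest_sub; first exact: sigma_algebra_measurable.
exact: box_cylinders_measurable.
Qed.

Lemma measurable_to_path_space d (T : measurableType d) (Y : nat -> T -> S) :
  (forall t, measurable_fun setT (Y t)) ->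
  measurable_fun setT (fun w => (fun t => Y t w) : (path_space S)).
Proof.
move=> mY.
refine (@measurability _ _ T (path_space S) setT (fun w i => Y i w)
  (@coordinate_cylinders _ S) erefl _).
move=> _ [_ [i [B [mB ->]]] <-].
exact: mY.
Qed.

Lemma measurable_shift : measurable_fun setT (shift : (path_space S) -> (path_space S)).
Proof. by apply: measurable_to_path_space => t; exact: measurable_coordinate. Qed.

End PathSpace.

(** * Maximal inequality and the one-sided ergodic bound *)

Section Stationary.
Context {R : realType} {d : measure_display} {Omega : measurableType d}.
Variable P : probability Omega R.
Context {dS : measure_display} {S : measurableType dS}.
Variable s : nat -> Omega -> S.
Hypothesis ms : forall t, measurable_fun setT (s t).
Hypothesis sP : stationary P s.

(** The laws of the path and of the shifted path agree on boxes, by stationarity with time lag 1,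
    and therefore on all measurable sets of paths. *)
Lemma stationary_ge0_integral_shift (h : path_space S -> R) :
  measurable_fun setT h -> (forall x, 0 <= h x) ->
  (\int[P]_w (h (shift (s ^~ w)))%:E = \int[P]_w (h (s ^~ w))%:E)%E.
Proof.
move=> mh h0.
have m1 := measurable_to_path_space ms.
have m2 := measurable_to_path_space (fun t => ms t.+1).
have /measurable_EFinP mEh := mh.
have h0' : {in setT, forall y : path_space S, (0 <= (EFin \o h) y)%E}.
  by move=> y _; rewrite lee_fin.
have := ge0_integral_pushforward m1 P measurableT mEh h0'.
have := ge0_integral_pushforward m2 P measurableT mEh h0'.
rewrite !preimage_setT /= => <- <-.
apply: eq_measure_integral => A mA _.
pose Y1 : {mfun Omega >-> path_space S} := mfun_Sub (mem_set m1).
pose Y2 : {mfun Omega >-> path_space S} := mfun_Sub (mem_set m2).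
refine (@measure_unique _ _ _ (@box_cylinders _ S) (fun=> setT) _ _ _ _
  (distribution P Y2) (distribution P Y1) _ _ A mA) => //.
- exact: path_space_measurableE.
- exact: setI_closed_box_cylinders.
- move=> _; exists 0, (fun=> setT); split => //.
  by apply/seteqP; split.
- by apply/seteqP; split => // x _; exists 0.
- move=> _ [k [B [mB ->]]].
  exact: (sP k 1 mB).
- by move=> k; exact: le_lt_trans
    (@probability_le1 _ _ _ (distribution P Y2) setT measurableT) (ltry _).
Qed.


Variables (g : path_space S -> R) (B : R).
Hypothesis mg : measurable_fun setT g.
Hypothesis gB : forall x, `|g x| <= B.

Definition ergodic_sum (n : nat) (x : path_space S) : R :=
  \sum_(k < n) g (fun i => x (k + i)%N).

Lemma ergodic_sumS n x : ergodic_sum n.+1 x = g x + ergodic_sum n (shift x).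
Proof.
by rewrite /ergodic_sum big_ord_recl; congr (_ + _); apply: eq_bigr => k _.
Qed.

(** The maximum of [ergodic_sum T x] over [T <= n], the empty sum included. The recursive form is
    the identity on which the maximal inequality rests. *)
Fixpoint running_max (n : nat) (x : path_space S) : R :=
  if n is n'.+1 then Num.max 0 (g x + running_max n' (shift x)) else 0.

Lemma running_max_ge0 n x : 0 <= running_max n x.
Proof. by case: n => [|n] //=; rewrite le_max lexx. Qed.

Lemma running_max_nondecreasing n x : running_max n x <= running_max n.+1 x.
Proof.
elim: n x => [|n IHn] x; first exact: running_max_ge0.
rewrite [leRHS]/= [leLHS]/= ge_max le_max lexx /= le_max.
by rewrite lerD2l [X in _ || X]IHn orbT.
Qed.

Lemma running_max_le n x : running_max n x <= n%:R * B.
Proof.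
elim: n x => [|n IHn] x /=; first by rewrite mul0r.
have B0 : 0 <= B by exact: le_trans (normr_ge0 _) (gB x).
rewrite ge_max mulr_ge0 //= -natr1 mulrDl mul1r addrC lerD //.
exact: le_trans (ler_norm _) (gB x).
Qed.

Lemma ergodic_sum_le_running_max n T x :
  (T <= n)%N -> ergodic_sum T x <= running_max n x.
Proof.
elim: n T x => [|n IHn] [|T] x //= Tn; rewrite ?[ergodic_sum 0 _]big_ord0 //.
  by rewrite le_max lexx.
by rewrite ergodic_sumS le_max lerD2l IHn // orbT.
Qed.

Lemma measurable_running_max n : measurable_fun setT (running_max n).
Proof.
elim: n => [|n IHn]; first exact: measurable_cst.
apply: measurable_maxr; first exact: measurable_cst.
apply: measurable_funD => //; exact: measurableT_comp IHn (@measurable_shift _ S).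
Qed.

Let path w : path_space S := s ^~ w.
Let mpath : measurable_fun setT path.
Proof. exact: measurable_to_path_space. Qed.

Lemma bounded_measurable_integrable (f : Omega -> R) (K : R) :
  measurable_fun setT f -> (forall w, `|f w| <= K) ->
  P.-integrable setT (EFin \o f).
Proof.
move=> mf fK; apply: measurable_bounded_integrable => //.
  exact: le_lt_trans (probability_le1 P measurableT) (ltry _).
by exists K; split; [exact: num_real|move=> y Ky x _ /=; apply: le_trans (fK x) (ltW Ky)].
Qed.

(* Garsia's argument for the maximal ergodic theorem. *)
Lemma integral_ge0_of_ergodic_sums_unbounded :
  {ae P, forall w, forall K : nat, exists T, K%:R < ergodic_sum T (shift (path w))} ->
  (0 <= \int[P]_w (g (path w))%:E)%E.
Proof.
move=> unb.
(* By the recursion, [h n] is [running_max n.+1] minus the shifted [running_max n]. Its integral is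
   nonnegative, because the shift preserves integrals and the running maximum grows with [n]. It
   also lies between [-B] and [B], so that dominated convergence applies. *)
pose h n w := Num.max (- running_max n (shift (path w))) (g (path w)).
have hE n w : h n w = running_max n.+1 (path w) - running_max n (shift (path w)).
  rewrite /h /= addr_maxl sub0r; congr Num.max; ring.
have mM n : measurable_fun setT (fun w => running_max n (path w)).
  exact: measurableT_comp (measurable_running_max n) mpath.
have mMs n : measurable_fun setT (fun w => running_max n (shift (path w))).
  apply: measurableT_comp (measurable_running_max n) _.
  exact: measurableT_comp (@measurable_shift _ S) mpath.
have iM n : P.-integrable setT (EFin \o (fun w => running_max n (path w))).
  apply: (bounded_measurable_integrable (K := n%:R * B)) => // w.
  by rewrite ger0_norm ?running_max_ge0 ?running_max_le.
have iMs n : P.-integrable setT (EFin \o (fun w => running_max n (shift (path w)))).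
  apply: (bounded_measurable_integrable (K := n%:R * B)) => // w.
  by rewrite ger0_norm ?running_max_ge0 ?running_max_le.
have h_ge0 n : (0 <= \int[P]_w (h n w)%:E)%E.
  under eq_integral do rewrite hE EFinB.
  rewrite integralB_EFin // (stationary_ge0_integral_shift (h := running_max n)).
  - rewrite sube_ge0; last by apply/orP; left; apply: integrable_fin_num (iM n).
    apply: ge0_le_integral => //; try exact/measurable_EFinP;
      by move=> w *; rewrite lee_fin ?running_max_ge0 ?running_max_nondecreasing.
  - exact: measurable_running_max.
  - by move=> x; exact: running_max_ge0.
have mgp : measurable_fun setT (fun w => g (path w)).
  exact: measurableT_comp mg mpath.
have mh n : measurable_fun setT (EFin \o h n).
  apply/measurable_EFinP; apply: measurable_maxr => //.
  exact: measurableT_comp.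
have gpw w : `|g (path w)| <= B by exact: gB.
have [_ _ cvgh] : [/\ P.-integrable setT (fun w => (g (path w))%:E),
    [sequence (\int[P]_w `|(h n w)%:E - (g (path w))%:E|)%E]_n @ \oo --> 0%E &
    [sequence (\int[P]_w (h n w)%:E)%E]_n @ \oo --> (\int[P]_w (g (path w))%:E)%E].
  apply: (@dominated_convergence _ _ _ _ _ _ _ _ (fun=> B%:E)) => //.
  - exact/measurable_EFinP.
  (* Once the running maximum of the shifted path exceeds [B], the first argument of the maximum is
     below [-B <= g], and [h n] equals [g] from then on. *)
  - apply: filterS unb => w unb_w _.
    have [N BN] : exists N : nat, B < N%:R.
      by exists (Num.truncn B).+1; rewrite truncnS_gt.
    have [T NT] := unb_w N.
    apply: cvg_near_cst; exists T => // n /= Tn.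
    congr _%:E; rewrite /h; apply: max_idPr.
    have := ergodic_sum_le_running_max (shift (path w)) Tn.
    have := gpw w; rewrite ler_norml => /andP[+ _].
    by move=> *; lra.
  - exact: finite_measure_integrable_cst.
  - apply: aeW => w n _; rewrite /= lee_fin ler_norml.
    have := gpw w; rewrite ler_norml => /andP[gl gu].
    have B0 : 0 <= B by exact: le_trans (normr_ge0 _) (gpw w).
    rewrite /h le_max gl orbT /= ge_max gu andbT.
    by rewrite (le_trans _ B0) // oppr_le0 running_max_ge0.
rewrite -(cvg_lim _ cvgh) //; apply: lime_ge.
  by apply/cvg_ex; eexists; exact: cvgh.
by near=> n; exact: h_ge0.
Unshelve. all: by end_near. Qed.

Definition unbounded_ergodic_sums : set (path_space S) :=
  [set x | forall K : nat, exists T, K%:R < ergodic_sum T x].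

(** Dropping the first term changes each sum by the fixed amount [g x], which a larger threshold
    absorbs. *)
Lemma unbounded_ergodic_sums_shift :
  shift @^-1` unbounded_ergodic_sums = unbounded_ergodic_sums.
Proof.
apply/seteqP; split => x /= unb K.
- have [T hT] := unb (Num.truncn (K%:R - g x)).+1.
  exists T.+1; rewrite ergodic_sumS.
  have := truncnS_gt (K%:R - g x); lra.
(* The absolute value keeps the threshold nonnegative, so the empty sum cannot exceed it and [T] is
   a successor. *)
- have [T hT] := unb (Num.truncn (K%:R + `|g x|)).+1.
  have tr := truncnS_gt (K%:R + `|g x|).
  have gx := ler_norm (g x).
  case: T hT => [|T].
    rewrite /ergodic_sum big_ord0 => hT.
    have : 0 <= K%:R + `|g x| by rewrite addr_ge0.
    lra.
  by rewrite ergodic_sumS => hT; exists T; lra.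
Qed.

Lemma measurable_ergodic_sum n : measurable_fun setT (ergodic_sum n).
Proof.
apply: measurable_sum => k; apply: (measurableT_comp mg).
by apply: measurable_to_path_space => t; exact: measurable_coordinate.
Qed.

Lemma measurable_unbounded_ergodic_sums : measurable unbounded_ergodic_sums.
Proof.
rewrite (_ : unbounded_ergodic_sums =
   \bigcap_(K in setT) \bigcup_T (ergodic_sum T @^-1` `]K%:R, +oo[)); last first.
  apply/seteqP; split => x /= h K.
    by move=> _; have [T hT] := h K; exists T => //=; rewrite in_itv /= hT.
  by have [T _ /=] := h K I; rewrite in_itv /= andbT => hT; exists T.
apply: bigcap_measurableType => K _; apply: bigcup_measurable => T _.
by rewrite -[X in measurable X]setTI; exact: measurable_ergodic_sum.
Qed.

Hypothesis sE : ergodic P s.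

(** Unboundedness is a shift-invariant event, so it has probability 0 or 1. Probability 1 would make
    the mean of [g] nonnegative by the maximal inequality. *)
Lemma ergodic_sums_bounded_above :
  (\int[P]_w (g (path w))%:E < 0)%E ->
  {ae P, forall w, exists K, forall T, ergodic_sum T (path w) <= K}.
Proof.
move=> g_lt0.
have mU : measurable (path @^-1` unbounded_ergodic_sums).
  rewrite -[X in measurable X]setTI.
  by apply: mpath => //; exact: measurable_unbounded_ergodic_sums.
have [P0|P1] := sE measurable_unbounded_ergodic_sums unbounded_ergodic_sums_shift.
  exists (path @^-1` unbounded_ergodic_sums); split => //.
  move=> w /= unb K; apply: contrapT => bnd; apply: unb.
  exists K%:R => T; rewrite leNgt; apply/negP => hT; apply: bnd; by exists T.
suff : (0 <= \int[P]_w (g (path w))%:E)%E by rewrite leNgt g_lt0.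
apply: integral_ge0_of_ergodic_sums_unbounded.
exists (~` (path @^-1` unbounded_ergodic_sums)); split.
- exact: measurableC.
- by rewrite probability_setC // [X in (1 - X)%E]P1 subee.
- move=> w /= nunb unb; apply: nunb.
  by rewrite /= -unbounded_ergodic_sums_shift in unb.
Qed.

End Stationary.

(** * Staircase approximation, integrals and conditional expectations *)

Lemma staircase_approx (R : realType) (j : nat) (c : R) : (0 < j)%N -> 0 <= c <= 1 ->
  `|c - \sum_(i < j) j%:R^-1 * (i.+1%:R / j%:R <= c)%R%:R| <= j%:R^-1.
Proof.
move=> j0 /andP[c0 c1].
have j0R : 0 < j%:R :> R by rewrite ltr0n.
pose k := Num.truncn (c * j%:R).
have cj0 : 0 <= c * j%:R by rewrite mulr_ge0 // ltW.
have /andP[k1 k2] := truncn_itv cj0.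
have kj : (k <= j)%N.
  by rewrite -(ler_nat R) (le_trans k1) // ler_piMl // ltW.
(* Exactly the first [k] levels are reached, so the staircase is [c] rounded down to a multiple of
   [1/j]. Written through level sets, it carries facts about indicators over to functions with
   values in [[0, 1]]. *)
have -> : \sum_(i < j) j%:R^-1 * (i.+1%:R / j%:R <= c)%R%:R = k%:R / j%:R :> R.
  rewrite -mulr_sumr mulrC; congr (_ / _).
  under eq_bigr => i _ do rewrite ler_pdivrMr // -truncn_ge_nat // -/k.
  rewrite -natr_sum; congr _%:R.
  rewrite -(big_mkord xpredT (fun i => (i < k)%N : nat)) /=.
  rewrite (big_cat_nat (n := k)) //= big_nat_cond.
  rewrite (eq_bigr (fun=> 1%N)); last by move=> i /andP[/andP[_ ->]].
  rewrite -big_nat_cond sum_nat_const_nat subn0 muln1 big_nat_cond big1 ?addn0 //.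
  by move=> i /andP[/andP[ki _] _]; rewrite ltnNge ki.
have -> : c - k%:R / j%:R = (c * j%:R - k%:R) / j%:R by field; rewrite gt_eqF.
rewrite normrM normfV (ger0_norm (ltW j0R)).
apply: ler_piMl; first by rewrite invr_ge0 ltW.
rewrite ler_norml; apply/andP; split; rewrite -?natr1 in k2 *; lra.
Qed.

Section Integrals.
Context {R : realType} {d : measure_display} {T : measurableType d}.
Variable P : probability T R.
Implicit Types f g : T -> R.
Local Notation intg f := (P.-integrable setT (EFin \o f)).

Lemma integrable_addr f g : intg f -> intg g -> intg (fun w => f w + g w).
Proof. by move=> If Ig; have := integrableD measurableT If Ig. Qed.

Lemma integrable_subr f g : intg f -> intg g -> intg (fun w => f w - g w).
Proof. by move=> If Ig; have := integrableB measurableT If Ig. Qed.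

Lemma integrable_scale k f : intg f -> intg (fun w => k * f w).
Proof. by move=> If; have := integrableZl measurableT k If. Qed.

Lemma integrable_normr f : intg f -> intg (fun w => `|f w|).
Proof. by move=> If; have := integrable_norm If. Qed.

Lemma integrable_big_sum n (f : 'I_n -> T -> R) : (forall i, intg (f i)) ->
  intg (fun w => \sum_(i < n) f i w).
Proof.
move=> If; elim: n f If => [|n IHn] f If.
  by under eq_fun do rewrite big_ord0; exact: finite_measure_integrable_cst.
under eq_fun do rewrite big_ord_recr.
by apply: integrable_addr => //; exact: IHn.
Qed.

Lemma integrable_bounded_mul (c f : T -> R) K : measurable_fun setT c ->
  (forall w, `|c w| <= K) -> intg f -> intg (fun w => c w * f w).
Proof.
move=> mc cK If; have -> : EFin \o (fun w => c w * f w) = ((EFin \o c) \* (EFin \o f))%E by [].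
apply: integrableMr => //; exists K; split; first exact: num_real.
by move=> y Ky x _ /=; apply: le_trans (cK x) (ltW Ky).
Qed.

Lemma Rintegral_big_sum n (f : 'I_n -> T -> R) A : measurable A -> (forall i, intg (f i)) ->
  \int[P]_(w in A) (\sum_(i < n) f i w) = \sum_(i < n) \int[P]_(w in A) f i w.
Proof.
move=> mA If; elim: n f If => [|n IHn] f If.
  rewrite big_ord0; under eq_Rintegral do rewrite big_ord0.
  by rewrite Rintegral_cst // mul0r.
rewrite big_ord_recr /= -IHn //; under eq_Rintegral do rewrite big_ord_recr.
rewrite RintegralD //; apply: integrableS (measurableT) _ _ _ => //.
by apply: integrable_big_sum.
Qed.

Lemma Rintegral_indic_mul (A : set T) f : \int[P]_w (\1_A w * f w) = \int[P]_(w in A) f w.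
Proof.
rewrite [RHS]Rintegral_mkcond; apply: eq_Rintegral => w _.
by rewrite /patch indicE; case: ifP => wA; rewrite ?mul1r ?mul0r.
Qed.

End Integrals.
Section ConditionalExpectation.
Context {R : realType} {d : measure_display} {T : measurableType d}.
Variable P : probability T R.
Implicit Types (f g V c : T -> R) (G : set (set T)).
Local Notation intg f := (P.-integrable setT (EFin \o f)).

Lemma integrable_on A f : measurable A -> intg f -> P.-integrable A (EFin \o f).
Proof. by move=> mA; apply: integrableS. Qed.

Lemma cond_exp_version_Rintegral G X Y A : cond_exp_version P G X Y -> G A ->
  \int[P]_(w in A) Y w = \int[P]_(w in A) X w.
Proof. by case=> _ [_ [_ h]] GA; rewrite /Rintegral h. Qed.

Lemma G_measurable_measurable G f : G `<=` measurable -> G_measurable G f ->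
  measurable_fun setT f.
Proof. by move=> Gm Gf _ B mB; rewrite setTI; exact/Gm/Gf. Qed.

Lemma eq0_of_norm_le_divn (x K : R) :
  (forall j, (0 < j)%N -> `|x| <= j%:R^-1 * K) -> x = 0.
Proof.
move=> h; apply/eqP; rewrite -normr_eq0; apply/eqP/le_anti; rewrite normr_ge0 andbT.
apply/ler_addgt0Pr => e e0; rewrite add0r.
pose j := (Num.truncn (`|K| / e)).+1.
have jK : `|K| / e < j%:R by exact: truncnS_gt.
apply: (le_trans (h j isT)); rewrite mulrC ler_pdivrMr ?ltr0n //.
rewrite ltr_pdivrMr // in jK; rewrite mulrC.
exact: le_trans (ler_norm _) (ltW jK).
Qed.

(** The staircase of [c] is a combination of indicators of sets in [G], each orthogonal to [V]. What
    remains is at most [1/j] times the L1 norm of [V], for every [j]. *)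
Lemma unit_interval_mul_Rintegral_eq0 G V c : G `<=` measurable ->
  intg V -> (forall A, G A -> \int[P]_(w in A) V w = 0) ->
  G_measurable G c -> (forall w, 0 <= c w <= 1) ->
  \int[P]_w (c w * V w) = 0.
Proof.
move=> Gm IV V0 Gc c01; apply: (@eq0_of_norm_le_divn _ (\int[P]_w `|V w|)) => j j0.
have mc := G_measurable_measurable Gm Gc.
pose A (i : 'I_j) := c @^-1` `[i.+1%:R / j%:R, +oo[.
have GA i : G (A i) by exact: Gc.
have mA i : measurable (A i) by exact: Gm.
pose e w := c w - \sum_(i < j) j%:R^-1 * \1_(A i) w.
have e_le w : `|e w| <= j%:R^-1.
  rewrite /e (_ : \sum_(i < j) _ = \sum_(i < j) j%:R^-1 * (i.+1%:R / j%:R <= c w)%R%:R).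
    exact: staircase_approx.
  apply: eq_bigr => i _; rewrite indicE; congr (_ * (nat_of_bool _)%:R).
  by apply/idP/idP; rewrite inE /A /= in_itv /= andbT.
have me : measurable_fun setT e.
  apply: measurable_funB => //; apply: measurable_sum => i.
  by apply: measurable_funM.
have Ie : intg (fun w => e w * V w) by exact: integrable_bounded_mul me e_le IV.
have I1 i : intg (fun w => \1_(A i) w * V w).
  apply: (integrable_bounded_mul (K := 1)) => //.
  by move=> w; rewrite indicE; case: (_ \in _); rewrite ?normr1 ?normr0.
have -> : \int[P]_w (c w * V w) = \int[P]_w (e w * V w).
  under [LHS]eq_Rintegral => w _.
    rewrite (_ : c w * V w = e w * V w + \sum_(i < j) j%:R^-1 * (\1_(A i) w * V w)).
      over.
    rewrite /e mulrBl mulr_suml; under [X in _ - X]eq_bigr do rewrite -mulrA.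
    by rewrite subrK.
  rewrite RintegralD //; last first.
    by apply: integrable_big_sum => i; exact: integrable_scale.
  rewrite Rintegral_big_sum //; last by move=> i; exact: integrable_scale.
  rewrite big1 ?addr0 // => i _.
  by rewrite RintegralZl // Rintegral_indic_mul V0 // mulr0.
apply: le_trans (le_normr_Rintegral measurableT Ie) _.
rewrite -RintegralZl //; last exact: integrable_normr.
apply: le_Rintegral => //; first exact: integrable_normr.
  by apply: integrable_scale; exact: integrable_normr.
by move=> w _; rewrite normrM ler_wpM2r.
Qed.

Lemma bounded_mul_Rintegral_eq0 G V c K : G `<=` measurable ->
  G setT -> intg V -> (forall A, G A -> \int[P]_(w in A) V w = 0) ->
  G_measurable G c -> (forall w, `|c w| <= K) ->
  \int[P]_w (c w * V w) = 0.
Proof.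
move=> Gm GT IV V0 Gc cK.
(* The [+ 1] keeps the affine rescaling of [c] into [[0, 1]] well defined even when [K = 0]. *)
pose K1 := `|K| + 1.
have K1gt0 : 0 < K1 by rewrite ltr_pwDr.
have cK1 w : `|c w| <= K1.
  by rewrite /K1 (le_trans (cK w)) // (le_trans (ler_norm K)) // lerDl.
pose c' w := (c w + K1) / (2 * K1).
have c'01 w : 0 <= c' w <= 1.
  have := cK1 w; rewrite ler_norml => /andP[h1 h2].
  rewrite /c' ler_pdivrMr ?mulr_gt0 // divr_ge0; lra.
have Gc' : G_measurable G c'.
  have m : measurable_fun setT (fun x : R => (x + K1) / (2 * K1)).
    by apply: measurable_funM => //; exact: measurable_funD.
  move=> B mB; have := m measurableT B mB; rewrite setTI => mB'.
  exact: Gc mB'.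
have mc' := G_measurable_measurable Gm Gc'.
have Ic' : intg (fun w => c' w * V w).
  apply: (integrable_bounded_mul (K := 1)) => // w.
  by have /andP[h1 h2] := c'01 w; rewrite ger0_norm.
under eq_Rintegral => w _.
  rewrite (_ : c w * V w = (2 * K1) * (c' w * V w) - K1 * V w); first over.
  by rewrite /c'; field; rewrite gt_eqF.
rewrite RintegralB //; [|exact: integrable_scale|exact: integrable_scale].
rewrite !RintegralZl // V0 // (unit_interval_mul_Rintegral_eq0 Gm IV V0 Gc') //.
by rewrite !mulr0 subr0.
Qed.

End ConditionalExpectation.

Section MarkovConditionalExpectation.
Context {R : realType} {d : measure_display} {Omega : measurableType d}.
Variable P : probability Omega R.
Context {dS : measure_display} {S : measurableType dS}.
Variables (F : nat -> set (set Omega)) (s : nat -> Omega -> S).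
Hypothesis filF : is_filtration F.
Hypothesis sF : forall t (B : set S), measurable B -> F t (s t @^-1` B).
Hypothesis sM : markov_wrt P F s.
Variables (X mu : S -> R) (t : nat).
Hypothesis mX : measurable_fun setT X.
Hypothesis X01 : forall x, 0 <= X x <= 1.
Hypothesis mmu : measurable_fun setT mu.
Hypothesis muX : cond_exp_version P (sigma_of (s t)) (X \o s t.+1) (mu \o s t).
Local Notation intg f := (P.-integrable setT (EFin \o f)).

(* The Markov property is about indicators; X is reached by staircases. *)
Lemma markov_cond_exp A : F t A ->
  \int[P]_(w in A) X (s t.+1 w) = \int[P]_(w in A) mu (s t w).
Proof.
have [_ [Fm _]] := filF.
have ms u : measurable_fun setT (s u).
  by move=> _ B mB; rewrite setTI; apply: (Fm u); exact: sF.
have mu_int : intg (fun w => mu (s t w)) by case: muX => _ [_ []].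
have X_int : intg (fun w => X (s t.+1 w)) by case: muX.
move=> FA; have mA := Fm _ _ FA.
(* Of the constant 3, one unit is the staircase error on [A]; the other two bound the L1 norm of [D]
   below, one for each sign. *)
apply/eqP; rewrite -subr_eq0; apply/eqP; apply: (@eq0_of_norm_le_divn _ _ 3) => j j0.
pose B (i : 'I_j) := X @^-1` `[i.+1%:R / j%:R, +oo[.
have mB i : measurable (B i) by rewrite -[X in measurable X]setTI; exact: mX.
have [g gP] : {g : 'I_j -> S -> R & forall i, measurable_fun setT (g i) /\
    cond_exp_version P (F t) (\1_(s t.+1 @^-1` B i)) (g i \o s t)}.
  by apply: (@choice _ _ (fun i gi => measurable_fun setT gi /\
    cond_exp_version P (F t) (\1_(s t.+1 @^-1` B i)) (gi \o s t))) => i; exact: sM.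
have Ig i : intg (fun w => g i (s t w)) by case: (gP i) => _ [_ [_ []]].
have I1 i : intg (\1_(s t.+1 @^-1` B i) : Omega -> R) by case: (gP i) => _ [].
pose H w := \sum_(i < j) j%:R^-1 * g i (s t w).
pose Q w := \sum_(i < j) j%:R^-1 * \1_(s t.+1 @^-1` B i) w : R.
have IH : intg H by apply: integrable_big_sum => i; exact: integrable_scale.
have IQ : intg Q by apply: integrable_big_sum => i; exact: integrable_scale.
have HQ A' : F t A' -> \int[P]_(w in A') H w = \int[P]_(w in A') Q w.
  move=> FA'; have mA' := Fm _ _ FA'.
  rewrite !Rintegral_big_sum //; try by move=> i; exact: integrable_scale.
  apply: eq_bigr => i _; rewrite !RintegralZl //; try exact: integrable_on.
  congr (_ * _); case: (gP i) => _ h.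
  exact: cond_exp_version_Rintegral h FA'.
have QX w : `|X (s t.+1 w) - Q w| <= j%:R^-1.
  rewrite /Q (_ : \sum_(i < j) _ =
      \sum_(i < j) j%:R^-1 * (i.+1%:R / j%:R <= X (s t.+1 w))%R%:R).
    exact: staircase_approx.
  apply: eq_bigr => i _; rewrite indicE; congr (_ * (nat_of_bool _)%:R).
  by apply/idP/idP; rewrite inE /B /= in_itv /= andbT.
have XH A' : F t A' ->
    `|\int[P]_(w in A') X (s t.+1 w) - \int[P]_(w in A') H w| <= j%:R^-1.
  move=> FA'; have mA' := Fm _ _ FA'.
  rewrite HQ // -RintegralB //; try exact: integrable_on.
  have IXQ := integrable_subr X_int IQ.
  apply: le_trans (le_normr_Rintegral mA' _) _; first exact: integrable_on.
  apply: (@le_trans _ _ (\int[P]_(w in A') j%:R^-1)).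
    apply: le_Rintegral => //; first by apply: integrable_on => //; exact: integrable_normr.
    exact: finite_measure_integrable_cst.
  rewrite Rintegral_cst // ler_piMr ?invr_ge0 //.
  rewrite -[1]/(fine 1%E) fine_le ?fin_num_measure //; exact: probability_le1.
(* Both terms are functions of [s t], so the sets where [D] is nonnegative or negative belong to
   [sigma_of (s t)], where the integrals of [D] are known to be small. This bounds the L1 norm of
   [D], and with it the integral of [D] over every set of [F t]. *)
pose D w := H w - mu (s t w).
have ID : intg D by exact: integrable_subr.
have sD B' : sigma_of (s t) B' -> `|\int[P]_(w in B') D w| <= j%:R^-1.
  move=> sB'; have FB' : F t B' by case: sB' => C mC <-; exact: sF.
  have mB' := Fm _ _ FB'.
  rewrite RintegralB //; try exact: integrable_on.
  have -> : \int[P]_(w in B') mu (s t w) = \int[P]_(w in B') X (s t.+1 w).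
    exact: cond_exp_version_Rintegral muX sB'.
  by rewrite distrC; exact: XH.
pose dd x := \sum_(i < j) j%:R^-1 * g i x - mu x.
have mdd : measurable_fun setT dd.
  apply: measurable_funB => //; apply: measurable_sum => i.
  by apply: measurable_funM => //; case: (gP i).
pose Bp := s t @^-1` (dd @^-1` `[0, +oo[).
pose Bn := s t @^-1` (dd @^-1` `]-oo, 0[).
have sBp : sigma_of (s t) Bp.
  by exists (dd @^-1` `[0, +oo[) => //; rewrite -[X in measurable X]setTI; exact: mdd.
have sBn : sigma_of (s t) Bn.
  by exists (dd @^-1` `]-oo, 0[) => //; rewrite -[X in measurable X]setTI; exact: mdd.
have mBp : measurable Bp by case: sBp => C mC <-; apply: (Fm t); exact: sF.
have mBn : measurable Bn by case: sBn => C mC <-; apply: (Fm t); exact: sF.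
have L1 : \int[P]_w `|D w| <= j%:R^-1 * 2.
  have -> : \int[P]_w `|D w| = \int[P]_w (\1_Bp w * D w - \1_Bn w * D w).
    apply: eq_Rintegral => w _; rewrite !indicE.
    have -> : w \in Bp = (0 <= D w).
      by apply/idP/idP; rewrite inE /Bp /= in_itv /= andbT.
    have -> : w \in Bn = (D w < 0).
      by apply/idP/idP; rewrite inE /Bn /= in_itv.
    case: (ltP (D w) 0) => h /=.
      by rewrite mul0r mul1r sub0r ltr0_norm.
    by rewrite mul0r mul1r subr0 ger0_norm.
  have Ind (C : set Omega) : measurable C -> intg (fun w => \1_C w * D w).
    move=> mC; apply: (integrable_bounded_mul (K := 1)) => //.
    by move=> w; rewrite indicE; case: (_ \in _); rewrite ?normr1 ?normr0.
  rewrite RintegralB //; try exact: Ind.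
  rewrite !Rintegral_indic_mul.
  have := sD _ sBp; have := sD _ sBn; rewrite !ler_norml => /andP[? ?] /andP[? ?].
  lra.
have DA : `|\int[P]_(w in A) D w| <= j%:R^-1 * 2.
  apply: le_trans (le_normr_Rintegral mA _) _; first exact: integrable_on.
  apply: le_trans L1; rewrite -Rintegral_indic_mul; apply: le_Rintegral => //.
  - apply: (integrable_bounded_mul (K := 1)); first exact: measurable_indic.
      by move=> w; rewrite indicE; case: (_ \in _); rewrite ?normr1 ?normr0.
    exact: integrable_normr.
  - exact: integrable_normr.
  - by move=> w _; rewrite indicE; case: (_ \in _); rewrite ?mul1r ?mul0r.
have := XH _ FA; move: DA; rewrite RintegralB //; try exact: integrable_on.
by rewrite !ler_norml => /andP[? ?] /andP[? ?]; apply/andP; split; lra.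
Qed.

End MarkovConditionalExpectation.

(** * Inequalities for the logarithm *)

Section Logarithm.
Context {R : realType}.
Implicit Types x y z K : R.

Lemma ln_le_subr1 z : 0 < z -> ln z <= z - 1.
Proof. by move=> z0; have := @le_ln1Dx R (z - 1); rewrite addrCA subrr addr0; apply; lra. Qed.

(* Apply [ln u <= u - 1] to [u = sqrt z]. *)
Lemma ln_le_quadratic K z : 1 <= K -> 0 < z <= K ->
  ln z <= z - 1 - (z - 1) ^+ 2 / (4 * K).
Proof.
move=> K1 /andP[z0 zK].
pose u := Num.sqrt z.
have u0 : 0 < u by rewrite sqrtr_gt0.
have zE : z = u ^+ 2 by rewrite sqr_sqrtr // ltW.
have lnz : ln z = ln u *+ 2 by rewrite zE lnXn.
have lnu := ln_le_subr1 u0.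
(* Indeed [2 * (u - 1) = z - 1 - (u - 1) ^+ 2]. The remaining inequality holds because
   [z - 1 = (u - 1) * (u + 1)] and [(u + 1) ^+ 2 <= 4 * K]. *)
suff : (z - 1) ^+ 2 / (4 * K) <= (u - 1) ^+ 2.
  rewrite lnz mulr2n; rewrite {2}zE; nra.
rewrite ler_pdivrMr; last by lra.
rewrite zE (_ : (u ^+ 2 - 1) ^+ 2 = (u - 1) ^+ 2 * (u + 1) ^+ 2); last by ring.
apply: ler_wpM2l; first exact: sqr_ge0.
have : 0 <= (u - 1) ^+ 2 by exact: sqr_ge0.
move: zK; rewrite zE; nra.
Qed.

(** Concavity between the points 1 and [z], using the tangent at their mean [y]: the two tangent
    bounds, weighted by [1 - p] and [p], cancel. *)
Lemma concave_ln_mix p z : 0 <= p <= 1 -> 0 < z -> p * ln z <= ln (1 - p + p * z).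
Proof.
move=> /andP[p0 p1] z0.
set y := 1 - p + p * z.
have y0 : 0 < y.
  rewrite /y; have [->|p1'] := eqVneq p 1; first by rewrite subrr add0r mul1r.
  have : p < 1 by rewrite lt_neqAle p1' p1.
  have := mulr_ge0 p0 (ltW z0); lra.
have h1 : ln z - ln y <= z / y - 1 by rewrite -ln_div // ln_le_subr1 // divr_gt0.
have h2 : - ln y <= y^-1 - 1 by rewrite -lnV // ln_le_subr1 // invr_gt0.
have h1' := ler_wpM2l p0 h1.
have q0 : 0 <= 1 - p by rewrite subr_ge0.
have h2' := ler_wpM2l q0 h2.
have E : p * (z / y - 1) + (1 - p) * (y^-1 - 1) = 0.
  have yn0 : y != 0 by rewrite gt_eqF.
  have yE : y = 1 - p + p * z by [].
  clearbody y; transitivity ((1 - p + p * z - y) / y); first by field.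
  by rewrite -yE subrr mul0r.
move: h1' h2'; rewrite mulrBr; lra.
Qed.

Lemma concave_ln_sum n (p r : 'I_n -> R) :
  in_simplex p -> (forall i, 0 < r i) ->
  \sum_(i < n) p i * ln (r i) <= ln (\sum_(i < n) p i * r i).
Proof.
move=> [p0 p1] r0; set y := \sum_(i < n) _ * r _.
have y0 : 0 < y.
  have : 0 <= y by apply: sumr_ge0 => i _; rewrite mulr_ge0 // ltW.
  rewrite le_eqVlt => /orP[/eqP /esym /eqP|//].
  rewrite psumr_eq0; last by move=> i _; rewrite mulr_ge0 // ltW.
  move=> /allP pr0.
  have : \sum_(i < n) p i = 0.
    apply: big1 => i _; have := pr0 i (mem_index_enum i).
    by rewrite mulf_eq0 (gt_eqF (r0 i)) orbF => /eqP.
  by rewrite p1 => /eqP; rewrite oner_eq0.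
rewrite -subr_le0 -[ln y]mul1r -p1 mulr_suml -sumrB.
apply: (@le_trans _ _ (\sum_(i < n) (p i * r i / y - p i))).
  apply: ler_sum => i _; rewrite -mulrBr (_ : p i * r i / y - p i = p i * (r i / y - 1));
    last by rewrite mulrBr mulr1 mulrA.
  by apply: ler_wpM2l => //; rewrite -ln_div ?ln_le_subr1 ?divr_gt0 // posrE.
by rewrite sumrB -mulr_suml -/y p1 divff ?subrr ?(gt_eqF y0).
Qed.

Lemma ln_sub_le b x y : 0 < b -> b <= y -> 0 < x -> ln x - ln y <= `|x - y| / b.
Proof.
move=> b0 bY x0; have y0 := lt_le_trans b0 bY.
rewrite -ln_div //; apply: le_trans (ln_le_subr1 (divr_gt0 x0 y0)) _.
rewrite (_ : x / y - 1 = (x - y) / y); last by field; rewrite gt_eqF.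
apply: (@le_trans _ _ (`|x - y| / y)).
  by rewrite ler_wpM2r ?invr_ge0 ?ler_norm // ltW.
by rewrite ler_wpM2l // lef_pV2 // posrE.
Qed.

End Logarithm.

(** * One step of the wealth dynamics *)

Section WealthStep.
Context {R : realType} {M N : nat}.
Variables (nu : 'I_M -> R) (lam : 'I_M -> 'I_N -> R) (x : 'I_N -> R).
Variables (W : 'I_M -> R) (delta : R) (m1 : 'I_M).
Hypothesis delta_gt0 : 0 < delta.
Hypothesis nu_itv : forall k, delta <= nu k <= 1.
Hypothesis lam_simplex : forall k, in_simplex (lam k).
Hypothesis lam_ge : forall k n, delta <= lam k n.
Hypothesis x_simplex : in_simplex x.
Hypothesis W_gt0 : forall k, 0 < W k.

Definition invested : R := \sum_(k < M) nu k * W k.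

(** An average of the strategies [lam k] weighted by the invested sums [nu k * W k]; it inherits
    their lower bound and their total. *)
Definition price (n : 'I_N) : R := (\sum_(k < M) nu k * lam k n * W k) / invested.

(** The prices [q] are a parameter because the factor is needed both at the market prices and at
    [mu]. *)
Definition growth (q : 'I_N -> R) (m : 'I_M) : R :=
  1 - nu m + nu m * \sum_(n < N) x n * (lam m n / q n).

Let nu_gt0 k : 0 < nu k.
Proof. by have /andP[h _] := nu_itv k; exact: lt_le_trans h. Qed.

Let lam_le1 k n : lam k n <= 1.
Proof.
have [l0 <-] := lam_simplex k; rewrite (bigD1 n) //= lerDl.
by apply: sumr_ge0 => i _; exact: l0.
Qed.

Let delta_le1 : delta <= 1.
Proof. by have /andP[h1 h2] := nu_itv m1; exact: le_trans h2. Qed.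

Lemma invested_gt0 : 0 < invested.
Proof.
rewrite /invested (bigD1 m1) //= ltr_pwDl ?mulr_gt0 //.
by apply: sumr_ge0 => k _; rewrite mulr_ge0 // ltW.
Qed.

Lemma price_itv n : delta <= price n <= 1.
Proof.
rewrite /price ler_pdivlMr ?invested_gt0 // ler_pdivrMr ?invested_gt0 // mul1r.
rewrite /invested mulr_sumr; apply/andP; split; apply: ler_sum => k _.
  by rewrite mulrA ler_wpM2r ?(ltW (W_gt0 k)) // mulrC ler_wpM2l // ltW.
by rewrite ler_wpM2r ?(ltW (W_gt0 k)) // ler_piMr // ltW.
Qed.

Lemma sum_price : \sum_(n < N) price n = 1.
Proof.
rewrite -mulr_suml exchange_big /= -[RHS](@divff _ invested); last first.
  by rewrite gt_eqF ?invested_gt0.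
congr (_ / _); apply: eq_bigr => k _.
by rewrite -mulr_suml -mulr_sumr (lam_simplex k).2 mulr1.
Qed.

Lemma wealth_stepE m : wealth_step nu lam x W m = W m * growth price m.
Proof.
have I0 : invested != 0 by rewrite gt_eqF ?invested_gt0.
rewrite /wealth_step /growth -/invested mulrDr [RHS]addrC mulrC; congr (_ + _); last exact: mulrC.
rewrite mulr_suml !mulr_sumr; apply: eq_bigr => n _.
have /andP[pn _] := price_itv n.
have := lt_le_trans delta_gt0 pn; rewrite /price.
set D := \sum_(k < M) _ => Dgt0.
have D0 : D != 0 by apply/eqP => D0; rewrite D0 mul0r ltxx in Dgt0.
by field; rewrite D0 I0.
Qed.

(** The factor is an average of 1 and of the ratios [lam m n / q n], all of which lie in this
    interval. *)
Lemma growth_itv (q : 'I_N -> R) m : (forall n, delta <= q n <= 1) ->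
  delta <= growth q m <= delta^-1.
Proof.
move=> hq.
have /andP[nud nu1] := nu_itv m.
have [x0 x1] := x_simplex.
have dV1 : 1 <= delta^-1 by rewrite invf_ge1.
have z1 : delta <= \sum_(n < N) x n * (lam m n / q n).
  rewrite -[leLHS]mul1r -x1 mulr_suml; apply: ler_sum => n _.
  have /andP[h1 h2] := hq n; have q0 := lt_le_trans delta_gt0 h1.
  apply: ler_wpM2l => //; rewrite ler_pdivlMr //.
  by apply: le_trans (lam_ge m n); rewrite ler_piMr // ltW.
have z2 : \sum_(n < N) x n * (lam m n / q n) <= delta^-1.
  rewrite -[leRHS]mul1r -x1 mulr_suml; apply: ler_sum => n _.
  have /andP[h1 h2] := hq n; have q0 := lt_le_trans delta_gt0 h1.
  apply: ler_wpM2l => //; rewrite -[leRHS]mul1r ler_pM ?invr_ge0 ?(ltW q0) //.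
    exact: le_trans (ltW delta_gt0) (lam_ge m n).
  by rewrite lef_pV2.
move: z1 z2; rewrite /growth; set z := \sum_(n < N) _ => z1 z2.
apply/andP; split.
  have : 0 <= nu m * (z - delta) by rewrite mulr_ge0 ?subr_ge0 // ltW.
  have : 0 <= (1 - nu m) * (1 - delta) by rewrite mulr_ge0 ?subr_ge0.
  lra.
have : 0 <= nu m * (delta^-1 - z) by rewrite mulr_ge0 ?subr_ge0 // ltW.
have : 0 <= (1 - nu m) * (delta^-1 - 1) by rewrite mulr_ge0 ?subr_ge0.
lra.
Qed.

Lemma wealth_step_ge m : delta * W m <= wealth_step nu lam x W m.
Proof.
rewrite wealth_stepE mulrC; have /andP[h _] := growth_itv m price_itv.
by rewrite ler_wpM2l // ltW.
Qed.

(** The shares of the agents in each outcome add up to one, so everything invested is paid out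
    again. *)
Lemma sum_wealth_step : \sum_(m < M) wealth_step nu lam x W m = \sum_(m < M) W m.
Proof.
rewrite /wealth_step -/invested big_split /= -mulr_sumr exchange_big /=.
rewrite (eq_bigr x).
  rewrite x_simplex.2 mulr1 /invested -big_split /=; apply: eq_bigr => k _; ring.
move=> n _; rewrite -mulr_suml -mulr_suml divff ?mul1r //.
have /andP[pn _] := price_itv n.
have := lt_le_trans delta_gt0 pn; rewrite /price => h.
by apply/eqP => D0; rewrite D0 mul0r ltxx in h.
Qed.

(* The bracket is the bound on [- ln (price / lam)] given by [ln_le_quadratic]. *)
Definition log_growth_weight (m : 'I_M) (n : 'I_N) : R :=
  nu m * (1 - price n / lam m n + (price n / lam m n - 1) ^+ 2 / (4 * delta^-1)).

Let lam_gt0 k n : 0 < lam k n.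
Proof. exact: lt_le_trans (lam_ge k n). Qed.

(** The lower bound is linear in the outcome [x], with weights that do not involve [x]; under the
    integral the outcome can then be replaced by its conditional mean. Concavity is used twice, for
    the uninvested part and for the average over outcomes. *)
Lemma ln_growth_ge m :
  \sum_(n < N) log_growth_weight m n * x n <= ln (growth price m).
Proof.
have [x0 x1] := x_simplex.
have /andP[nud nu1] := nu_itv m.
have p0 n : 0 < price n by have /andP[h _] := price_itv n; exact: lt_le_trans h.
have r0 n : 0 < lam m n / price n by rewrite divr_gt0.
have z0 : 0 < \sum_(n < N) x n * (lam m n / price n).
  have nz : delta * 1 <= \sum_(n < N) x n * (lam m n / price n).
    rewrite -x1 mulr_sumr; apply: ler_sum => n _; rewrite mulrC ler_wpM2l //.
    rewrite ler_pdivlMr //; have /andP[_ h] := price_itv n.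
    by apply: le_trans (lam_ge m n); rewrite ler_piMr // ltW.
  by apply: lt_le_trans nz; rewrite mulr1.
apply: le_trans (concave_ln_mix _ z0); last by rewrite nu1 ltW.
apply: (@le_trans _ _ (nu m * \sum_(n < N) x n * ln (lam m n / price n))); last first.
  by rewrite ler_wpM2l ?(ltW (nu_gt0 m)) // concave_ln_sum.
rewrite mulr_sumr; apply: ler_sum => n _.
rewrite /log_growth_weight -mulrA ler_wpM2l ?(ltW (nu_gt0 m)) // mulrC ler_wpM2l //.
have dV1 : 1 <= delta^-1 by rewrite invf_ge1.
have := @ln_le_quadratic R delta^-1 (price n / lam m n) dV1.
have -> : ln (lam m n / price n) = - ln (price n / lam m n).
  by rewrite -lnV ?invf_div // posrE divr_gt0.
have -> : 0 < price n / lam m n <= delta^-1.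
  rewrite divr_gt0 //= -[leRHS]mul1r; have /andP[_ h] := price_itv n.
  by rewrite ler_pM ?invr_ge0 ?(ltW (p0 n)) ?(ltW (lam_gt0 m n)) // lef_pV2 // posrE.
by move=> /(_ isT); lra.
Qed.

(** At the point [x = lam m] the linear terms cancel, since prices and strategy both sum to one. In
    the quadratic term one [delta] comes from [nu m], the other from the constant in
    [log_growth_weight], and the division by [lam m n <= 1] only helps. *)
Lemma sum_log_growth_weight m :
  delta ^+ 2 / 4 * \sum_(n < N) (price n - lam m n) ^+ 2 <=
  \sum_(n < N) log_growth_weight m n * lam m n.
Proof.
have -> : \sum_(n < N) log_growth_weight m n * lam m n =
    \sum_(n < N) nu m * (delta / 4 * ((price n - lam m n) ^+ 2 / lam m n)).
  rewrite -[RHS]addr0 -[X in _ + X](_ : \sum_(n < N) nu m * (lam m n - price n) = 0).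
    rewrite -big_split /=; apply: eq_bigr => n _; rewrite /log_growth_weight.
    by field; rewrite !gt_eqF.
  by rewrite -mulr_sumr sumrB (lam_simplex m).2 sum_price subrr mulr0.
rewrite mulr_sumr; apply: ler_sum => n _.
have /andP[nud nu1] := nu_itv m.
have q0 : 0 <= (price n - lam m n) ^+ 2 by exact: sqr_ge0.
rewrite expr2 -!mulrA ler_pM ?(ltW delta_gt0) //.
  by rewrite mulr_ge0 ?(ltW delta_gt0) // mulr_ge0.
rewrite ler_pM2l // ler_pM2l ?invr_gt0 ?ltr0n //.
by rewrite mulrA -expr2 ler_peMr // invf_ge1.
Qed.

Lemma log_growth_weight_bounded m n :
  `|log_growth_weight m n| <= 1 + delta^-1 + (delta^-1 + 1) ^+ 2.
Proof.
have /andP[nud nu1] := nu_itv m.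
have /andP[pd p1] := price_itv n.
have dV1 : 1 <= delta^-1 by rewrite invf_ge1.
have r0 : 0 <= price n / lam m n.
  by rewrite divr_ge0 ?(ltW (lam_gt0 m n)) // (le_trans (ltW delta_gt0)).
have r1 : price n / lam m n <= delta^-1.
  rewrite -[leRHS]mul1r ler_pM ?invr_ge0 ?(ltW (lam_gt0 m n)) //.
    by rewrite (le_trans (ltW delta_gt0)).
  by rewrite lef_pV2 // posrE.
move: r0 r1; rewrite /log_growth_weight; set r := price n / lam m n => r0 r1.
rewrite normrM -[leRHS]mul1r ler_pM //.
  by rewrite ger0_norm // ltW.
apply: (le_trans (ler_normD _ _)); apply: lerD.
  by rewrite ler_norml; apply/andP; split; lra.
rewrite ger0_norm; last by rewrite divr_ge0 ?sqr_ge0 //; lra.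
apply: (@le_trans _ _ ((r - 1) ^+ 2)).
  by rewrite ler_piMr ?sqr_ge0 // invf_le1 //; lra.
by rewrite -real_normK ?num_real // lerXn2r ?nnegrE //; [lra|rewrite ler_norml; lra].
Qed.

(** One factor [delta^-1] is the slope of [ln] above [delta]; the other two come from the difference
    of [1 / price n] and [1 / q n]. *)
Lemma ln_growth_price_le (q : 'I_N -> R) m : (forall n, delta <= q n <= 1) ->
  ln (growth price m) - ln (growth q m) <=
  delta ^- 3 * \sum_(n < N) `|price n - q n|.
Proof.
move=> hq; have [x0 x1] := x_simplex.
have /andP[g1 _] := growth_itv m hq.
have /andP[g2 _] := growth_itv m price_itv.
apply: le_trans (ln_sub_le delta_gt0 g1 (lt_le_trans delta_gt0 g2)) _.
rewrite ler_pdivrMr //.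
have -> : delta ^- 3 * (\sum_(n < N) `|price n - q n|) * delta =
   \sum_(n < N) delta ^- 2 * `|price n - q n|.
  by rewrite -mulr_sumr; field; rewrite gt_eqF.
have -> : growth price m - growth q m =
    \sum_(n < N) nu m * (x n * (lam m n / price n - lam m n / q n)).
  rewrite /growth -mulr_sumr; under [in RHS]eq_bigr do rewrite mulrBr.
  by rewrite sumrB; ring.
apply: le_trans (ler_norm_sum _ _ _) _; apply: ler_sum => n _.
have /andP[q0 q1] := hq n; have /andP[p0 p1] := price_itv n.
have qgt := lt_le_trans delta_gt0 q0; have pgt := lt_le_trans delta_gt0 p0.
have /andP[nud nu1] := nu_itv m.
have xn1 : x n <= 1.
  by rewrite -x1 (bigD1 n) //= lerDl; apply: sumr_ge0 => i _; exact: x0.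
rewrite (_ : lam m n / price n - lam m n / q n =
  lam m n * ((q n - price n) / (price n * q n))); last first.
  by field; rewrite !gt_eqF.
rewrite !normrM normfV normrM (gtr0_norm pgt) (gtr0_norm qgt) (gtr0_norm (nu_gt0 m)).
rewrite (ger0_norm (x0 n)) (gtr0_norm (lam_gt0 m n)) distrC.
have e0 : 0 <= `|price n - q n| / (price n * q n) by rewrite divr_ge0 // ltW // mulr_gt0.
apply: le_trans (ler_piMl _ nu1) _.
  by apply: mulr_ge0 => //; apply: mulr_ge0 => //; exact: ltW.
apply: le_trans (ler_piMl _ xn1) _.
  by apply: mulr_ge0 => //; exact: ltW.
apply: le_trans (ler_piMl e0 (lam_le1 m n)) _.
have pq0 : 0 < price n * q n by exact: mulr_gt0.
rewrite mulrC ler_wpM2r // lef_pV2 ?posrE ?exprn_gt0 //.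
by rewrite expr2 ler_pM // ltW.
Qed.

End WealthStep.

(** * Measurability of the inverse and convergence criteria *)

Lemma measurable_invr (R : realType) : measurable_fun setT (fun x : R => x^-1).
Proof.
(* This is [x / x ^+ 2]; at 0 the leading factor gives 0, in agreement with the convention for
   [0^-1]. *)
have -> : (fun x : R => x^-1) = (fun x => x * expR (- ln (x ^+ 2))).
  apply/funext => x; have [->|x0] := eqVneq x 0; first by rewrite invr0 mul0r.
  have x2 : 0 < x ^+ 2 by rewrite exprn_even_gt0.
  by rewrite -lnV // lnK ?posrE ?invr_gt0 //; field.
apply: measurable_funM => //; apply: measurableT_comp => //.
by apply: measurableT_comp => //; apply: measurableT_comp => //.
Qed.

Lemma cvg0_of_bounded_series (R : realType) (q : nat -> R) (K : R) :
  (forall t, 0 <= q t) -> (forall n, \sum_(t < n) q t <= K) -> q @ \oo --> 0.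
Proof.
move=> q0 qK; apply: cvg_series_cvg_0; apply: nondecreasing_is_cvgn.
  by apply: nondecreasing_series => *; exact: q0.
exists K => _ [n _ <-]; rewrite /series /= big_mkord; exact: qK.
Qed.

Section SummableExpectations.
Context {R : realType} {d : measure_display} {T : measurableType d}.
Variable P : probability T R.
Local Notation intg f := (P.-integrable setT (EFin \o f)).

(** By monotone convergence the series has finite expectation, so it is finite almost everywhere and
    its terms vanish in the limit. *)
Lemma ae_cvg0_of_summable_Rintegral (q : nat -> T -> R) (K : R) :
  (forall t, intg (q t)) -> (forall t w, 0 <= q t w) ->
  (forall n, \sum_(t < n) \int[P]_w q t w <= K) ->
  {ae P, forall w, q ^~ w @ \oo --> 0}.
Proof.
move=> Iq q0 qK.
have mq t : measurable_fun setT (fun w => (q t w)%:E).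
  by case/integrableP: (Iq t).
have Eq t : (\int[P]_w (q t w)%:E = (\int[P]_w q t w)%:E)%E.
  by rewrite fineK //; apply: integrable_fin_num (Iq t).
have q0E t w : (0 <= (q t w)%:E)%E by rewrite lee_fin.
have Isum : P.-integrable setT (fun w => \sum_(t <oo) (q t w)%:E)%E.
  apply/integrableP; split.
    by apply: ge0_emeasurable_sum => // *.
  under eq_integral do rewrite gee0_abs ?nneseries_ge0 //.
  rewrite integral_nneseries //.
  apply: (@le_lt_trans _ _ K%:E); last exact: ltry.
  apply: lime_le; first by apply: is_cvg_nneseries => *; exact: integral_ge0.
  apply: nearW => n; rewrite big_mkord.
  under eq_bigr do rewrite Eq.
  by rewrite sumEFin lee_fin.
have := integrable_ae measurableT Isum.
apply: filterS => w /(_ I) fin.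
apply: (@cvg0_of_bounded_series _ _ (fine (\sum_(t <oo) (q t w)%:E)%E)) => // n.
rewrite -lee_fin fineK // -sumEFin -(big_mkord xpredT (fun t => (q t w)%:E)).
exact: nneseries_lim_ge.
Qed.

End SummableExpectations.

(** In the application [L] is a log-wealth, [S] the sum of the stationary growth terms and [r] the
    price error. Half of the slope [2 * b] absorbs [r] once [r <= b]; the other half drives [L] to
    minus infinity. *)
Lemma expR_cvg0_of_drift (R : realType) (L S r : nat -> R) (K b : R) : 0 < b ->
  (forall t, L t.+1 <= L t + (S t.+1 - S t) + r t) ->
  (forall t, S t + 2 * b * t%:R <= K) ->
  r @ \oo --> 0 -> (fun t => expR (L t)) @ \oo --> 0.
Proof.
move=> b0 LS SK r0.
have [T _ rb] : \forall t \near \oo, r t <= b.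
  have : \forall t \near \oo, `|r t - 0| < b by exact: (@cvgr_distC_lt _ _ _ _ _ _ _ r0).
  by apply: filterS => t; rewrite subr0 => h; exact: le_trans (ler_norm _) (ltW h).
have Lb t : L (T + t)%N <= L T - S T + S (T + t)%N + b * t%:R.
  elim: t => [|t IHt]; first by rewrite addn0 mulr0 addr0 subrK.
  have := LS (T + t)%N; have := rb (T + t)%N (leq_addr _ _).
  rewrite addnS -natr1 mulrDr mulr1; lra.
pose A := L T - S T + K.
(* The bound [1 + y <= expR y] turns linear decay of [L] into a rational bound that clearly tends to
   0. *)
have expA t : expR (L (T + t)%N) <= expR A / (1 + b * t%:R).
  have bt : 0 <= b * t%:R by rewrite mulr_ge0 // ltW.
  rewrite ler_pdivlMr; last by lra.
  apply: (@le_trans _ _ (expR (L (T + t)%N) * expR (b * t%:R))).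
    by rewrite ler_wpM2l ?expR_ge0 // expR_ge1Dx.
  rewrite -expRD ler_expR.
  have := Lb t; have := SK (T + t)%N; rewrite natrD.
  have : 0 <= b * T%:R by rewrite mulr_ge0 // ltW.
  rewrite /A; lra.
rewrite -(cvg_shiftn T); apply: (@squeeze_cvgr _ _ _ _ (fun=> 0)
  (fun t => expR A / (1 + b * t%:R))).
- by apply: nearW => t; rewrite expR_ge0 /= addnC.
- exact: cvg_cst.
- apply/cvgrPdist_le => e e0; near=> t.
  rewrite sub0r normrN ger0_norm; last first.
    by rewrite divr_ge0 ?expR_ge0 // addr_ge0 // mulr_ge0 // ltW.
  rewrite ler_pdivrMr; last by rewrite ltr_pwDl // mulr_ge0 // ltW.
  apply: (@le_trans _ _ (e * (b * t%:R))); last by rewrite ler_wpM2l ?lerDr // ltW.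
  rewrite mulrA mulrC -ler_pdivrMr ?mulr_gt0 //.
  by near: t; exact: nbhs_infty_ger.
Unshelve. all: by end_near. Qed.

(** * The market along a trajectory: bounds, adaptedness, integrability *)

Section PredictionMarket.
Context {R : realType} {d : measure_display} {Omega : measurableType d}.
Variable P : probability Omega R.
Context {dS : measure_display} {S : measurableType dS} {N M : nat}.
Variables (F : nat -> set (set Omega)) (s : nat -> Omega -> S).
Variables (X mu : S -> 'I_N -> R) (W0 : 'I_M -> R).
Variables (nu : 'I_M -> S -> R) (lam : 'I_M -> S -> 'I_N -> R).
Variables (m1 : 'I_M) (delta : R).
Hypothesis filF : is_filtration F.
Hypothesis sF : forall t (B : set S), measurable B -> F t (s t @^-1` B).
Hypothesis mX : forall n, measurable_fun setT (fun x => X x n).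
Hypothesis X_simplex : forall x, in_simplex (X x).
Hypothesis mmu : forall n, measurable_fun setT (fun x => mu x n).
Hypothesis W0_gt0 : forall m, 0 < W0 m.
Hypothesis mnu : forall m, measurable_fun setT (nu m).
Hypothesis mlam : forall m n, measurable_fun setT (fun x => lam m x n).
Hypothesis nu01 : forall m x, 0 <= nu m x <= 1.
Hypothesis lam_simplex : forall m x, in_simplex (lam m x).
Hypothesis delta_gt0 : 0 < delta.
Hypothesis delta_le : forall m t w,
  delta <= nu m (s t w) /\ forall n, delta <= lam m (s t w) n.
Hypothesis lam1_mu : forall x n, lam m1 x n = mu x n.
Local Notation intg f := (P.-integrable setT (EFin \o f)).

Let nu_ t w k := nu k (s t w).
Let lam_ t w k n := lam k (s t w) n.

Definition agent_wealth t w : 'I_M -> R :=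
  wealth W0 (fun t k => nu k (s t w)) (fun t k n => lam k (s t w) n)
    (fun t n => X (s t w) n) t.

Definition market_price t w : 'I_N -> R :=
  price (nu_ t w) (lam_ t w) (agent_wealth t w).

Definition log_growth m (x y : S) : R :=
  ln (growth (nu ^~ x) (lam ^~ x) (X y) (mu x) m).

Let nu_itv t w k : delta <= nu_ t w k <= 1.
Proof. by have /andP[_ ->] := nu01 k (s t w); rewrite (delta_le k t w).1. Qed.

Let lam_ge t w k n : delta <= lam_ t w k n.
Proof. exact: (delta_le k t w).2. Qed.

Let lam_sim t w k : in_simplex (lam_ t w k).
Proof. exact: lam_simplex. Qed.

Lemma agent_wealth_gt0 t w k : 0 < agent_wealth t w k.
Proof.
elim: t k => [|t IHt] k //=.
have := wealth_step_ge m1 delta_gt0 (nu_itv t w) (lam_sim t w) (lam_ge t w)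
  (X_simplex (s t.+1 w)) IHt k.
by apply: lt_le_trans; rewrite mulr_gt0.
Qed.

(** A non-random lower bound for each [t], which makes the log-wealth bounded and hence integrable
    at each time. *)
Lemma agent_wealth_ge t w k : delta ^+ t * W0 k <= agent_wealth t w k.
Proof.
elim: t => [|t IHt]; first by rewrite expr0 mul1r.
have := wealth_step_ge m1 delta_gt0 (nu_itv t w) (lam_sim t w) (lam_ge t w)
  (X_simplex (s t.+1 w)) (agent_wealth_gt0 t w) k.
by apply: le_trans; rewrite exprS -mulrA ler_wpM2l // ltW.
Qed.

Lemma agent_wealthS t w k : agent_wealth t.+1 w k = agent_wealth t w k *
  growth (nu_ t w) (lam_ t w) (X (s t.+1 w)) (market_price t w) k.
Proof.
exact: (wealth_stepE (X (s t.+1 w)) m1 delta_gt0 (nu_itv t w) (lam_sim t w) (lam_ge t w)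
  (agent_wealth_gt0 t w)).
Qed.

Lemma sum_agent_wealth t w : \sum_(k < M) agent_wealth t w k = \sum_(k < M) W0 k.
Proof.
elim: t => [//|t IHt]; rewrite -IHt.
exact: (sum_wealth_step m1 delta_gt0 (nu_itv t w) (lam_sim t w) (lam_ge t w)
  (X_simplex (s t.+1 w)) (agent_wealth_gt0 t w)).
Qed.

Lemma agent_wealth_le t w k : agent_wealth t w k <= \sum_(k < M) W0 k.
Proof.
rewrite -(sum_agent_wealth t w) (bigD1 k) //= lerDl.
by apply: sumr_ge0 => i _; rewrite ltW // agent_wealth_gt0.
Qed.

Lemma market_price_itv t w n : delta <= market_price t w n <= 1.
Proof.
exact: (price_itv m1 delta_gt0 (nu_itv t w) (lam_sim t w) (lam_ge t w)
  (agent_wealth_gt0 t w)).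
Qed.

Let mu_itv t w n : delta <= mu (s t w) n <= 1.
Proof.
rewrite -lam1_mu lam_ge /=; have [l0 <-] := lam_simplex m1 (s t w).
by rewrite (bigD1 n) //= lerDl; apply: sumr_ge0 => i _; exact: l0.
Qed.

Lemma ln_agent_wealthS t w k : ln (agent_wealth t.+1 w k) = ln (agent_wealth t w k) +
  ln (growth (nu_ t w) (lam_ t w) (X (s t.+1 w)) (market_price t w) k).
Proof.
rewrite agent_wealthS lnM // posrE ?agent_wealth_gt0 //.
have /andP[h _] := growth_itv m1 delta_gt0 (nu_itv t w) (lam_sim t w)
  (lam_ge t w) (X_simplex (s t.+1 w)) k (market_price_itv t w).
exact: lt_le_trans h.
Qed.

(** Adaptedness is expressed as measurability on [Omega] carrying the sigma-algebra generated by
    [F t], so that the usual closure lemmas apply; [G_measurable_of_adapted] translates back. *)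
Let measurable_s u t : (u <= t)%N ->
  measurable_fun setT (fun w : g_sigma_algebraType (F t) => s u w).
Proof.
move=> ut _ B mB; rewrite setTI; apply: sub_sigma_algebra.
by apply: filF.2.2 ut _ _; exact: sF.
Qed.

Let comp_s (f : S -> R) u t : (u <= t)%N -> measurable_fun setT f ->
  measurable_fun setT (fun w : g_sigma_algebraType (F t) => f (s u w)).
Proof. by move=> ut mf; exact: measurableT_comp mf (measurable_s ut). Qed.

Lemma measurable_agent_wealth u t k : (u <= t)%N ->
  measurable_fun setT (fun w : g_sigma_algebraType (F t) => agent_wealth u w k).
Proof.
elim: u k => [|u IHu] k ut; first exact: measurable_cst.
have ut' := ltnW ut.
apply: measurable_funD; apply: measurable_funM.
- apply: measurable_sum => i; apply: measurable_funM; last exact: IHu.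
  exact: comp_s.
- apply: measurable_sum => n; apply: measurable_funM; last exact: (comp_s ut (mX n)).
  apply: measurable_funM.
    apply: measurable_funM; last exact: IHu.
    by apply: measurable_funM; [exact: comp_s|exact: (comp_s ut' (mlam _ _))].
  apply: (measurableT_comp (@measurable_invr R)); apply: measurable_sum => i.
  apply: measurable_funM; last exact: IHu.
  by apply: measurable_funM; [exact: comp_s|exact: (comp_s ut' (mlam _ _))].
- by apply: measurable_funB; [exact: measurable_cst|exact: comp_s].
- exact: IHu.
Qed.

Lemma measurable_market_price t n :
  measurable_fun setT (fun w : g_sigma_algebraType (F t) => market_price t w n).
Proof.
apply: measurable_funM.
  apply: measurable_sum => i; apply: measurable_funM; last exact: measurable_agent_wealth.
  by apply: measurable_funM; [exact: comp_s|exact: (comp_s (leqnn _) (mlam _ _))].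
apply: (measurableT_comp (@measurable_invr R)); apply: measurable_sum => i.
by apply: measurable_funM; [exact: comp_s|exact: measurable_agent_wealth].
Qed.

Lemma G_measurable_of_adapted t (f : Omega -> R) :
  measurable_fun setT (fun w : g_sigma_algebraType (F t) => f w) -> G_measurable (F t) f.
Proof.
move=> mf B mB; have := mf measurableT B mB.
by rewrite setTI /measurable /= sigma_algebra_id //; exact: filF.1.
Qed.

Lemma measurable_of_adapted t (f : Omega -> R) :
  measurable_fun setT (fun w : g_sigma_algebraType (F t) => f w) -> measurable_fun setT f.
Proof. by move=> /G_measurable_of_adapted; apply: G_measurable_measurable; exact: filF.2.1. Qed.

Let weight t w n := log_growth_weight (nu_ t w) (lam_ t w) (agent_wealth t w) delta m1 n.

Lemma measurable_weight t n :
  measurable_fun setT (fun w : g_sigma_algebraType (F t) => weight t w n).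
Proof.
have mr : measurable_fun setT
    (fun w : g_sigma_algebraType (F t) => market_price t w n / lam_ t w m1 n).
  apply: measurable_funM; first exact: measurable_market_price.
  apply: (measurableT_comp (@measurable_invr R)); exact: (comp_s (leqnn _) (mlam _ _)).
apply: measurable_funM; first exact: comp_s.
apply: measurable_funD; first by apply: measurable_funB => //; exact: measurable_cst.
apply: measurable_funM; last exact: measurable_cst.
by apply: measurable_funX; apply: measurable_funB => //; exact: measurable_cst.
Qed.

Let msO t : measurable_fun setT (s t).
Proof. by move=> _ B mB; rewrite setTI; apply: (filF.2.1 t); exact: sF. Qed.

Let X01 x n : 0 <= X x n <= 1.
Proof.
have [x0 <-] := X_simplex x; rewrite x0 /= (bigD1 n) //= lerDl.
by apply: sumr_ge0 => i _; exact: x0.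
Qed.

Let IX t n : intg (fun w => X (s t w) n).
Proof.
apply: (bounded_measurable_integrable P (K := 1)).
  exact: measurableT_comp (mX n) (msO t).
by move=> w; have /andP[h1 h2] := X01 (s t w) n; rewrite ger0_norm.
Qed.

Let Imu t n : intg (fun w => mu (s t w) n).
Proof.
apply: (bounded_measurable_integrable P (K := 1)).
  exact: measurableT_comp (mmu n) (msO t).
move=> w; have /andP[h1 h2] := mu_itv t w n; rewrite ger0_norm //.
exact: le_trans (ltW delta_gt0) h1.
Qed.

(** [G] is left open for two uses: [F t], with weights that depend on the wealths, and
    [sigma_of (s t)], with weights that depend on the current state. *)
Lemma Rintegral_mul_outcome G t (c : 'I_N -> Omega -> R) (K : R) :
  G `<=` measurable -> G setT ->
  (forall n A, G A -> \int[P]_(w in A) X (s t.+1 w) n = \int[P]_(w in A) mu (s t w) n) ->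
  (forall n, G_measurable G (c n)) -> (forall n w, `|c n w| <= K) ->
  \int[P]_w (\sum_(n < N) c n w * X (s t.+1 w) n) =
  \int[P]_w (\sum_(n < N) c n w * mu (s t w) n).
Proof.
move=> Gm GT E Gc cK.
have IcX n : intg (fun w => c n w * X (s t.+1 w) n).
  by apply: integrable_bounded_mul (cK n) (IX _ _); exact: G_measurable_measurable (Gc n).
have Icmu n : intg (fun w => c n w * mu (s t w) n).
  by apply: integrable_bounded_mul (cK n) (Imu _ _); exact: G_measurable_measurable (Gc n).
rewrite !Rintegral_big_sum //; apply: eq_bigr => n _.
apply/eqP; rewrite -subr_eq0 -RintegralB //; apply/eqP.
under eq_Rintegral do rewrite -mulrBr.
apply: (@bounded_mul_Rintegral_eq0 _ _ _ _ G _ _ K) => //.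
  exact: integrable_subr.
move=> A GA; rewrite RintegralB //; try by apply: integrable_on => //; exact: Gm.
  by rewrite E // subrr.
exact: Gm.
Qed.

Let price_gap t w := \sum_(n < N) (market_price t w n - mu (s t w) n) ^+ 2.

Let lnW t w := ln (agent_wealth t w m1).

Lemma integrable_ln_wealth t : intg (lnW t).
Proof.
have mW : measurable_fun setT (lnW t).
  apply: measurable_of_adapted (t) _ _.
  exact: measurableT_comp (@measurable_ln R) (measurable_agent_wealth m1 (leqnn t)).
pose C := \sum_(k < M) W0 k.
apply: (bounded_measurable_integrable P (K := `|ln (delta ^+ t * W0 m1)| + `|ln C|)) => // w.
have h1 : ln (delta ^+ t * W0 m1) <= lnW t w.
  by rewrite ler_ln ?posrE ?agent_wealth_ge ?agent_wealth_gt0 // mulr_gt0 ?exprn_gt0.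
have h2 : lnW t w <= ln C.
  rewrite ler_ln ?posrE ?agent_wealth_gt0 ?agent_wealth_le //.
  exact: lt_le_trans (agent_wealth_gt0 t w m1) (agent_wealth_le t w m1).
have := ler_norm (ln C); have := ler_norm (- ln (delta ^+ t * W0 m1)); rewrite normrN.
have := normr_ge0 (ln C); have := normr_ge0 (ln (delta ^+ t * W0 m1)).
by move=> *; rewrite ler_norml; apply/andP; split; lra.
Qed.

Let price_gap_ge0 t w : 0 <= price_gap t w.
Proof. by apply: sumr_ge0 => n _; exact: sqr_ge0. Qed.

Lemma integrable_price_gap t : intg (price_gap t).
Proof.
apply: (bounded_measurable_integrable P (K := N%:R)).
  apply: measurable_of_adapted (t) _ _; apply: measurable_sum => n.
  apply: measurable_funX; apply: measurable_funB; first exact: measurable_market_price.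
  exact: (comp_s (leqnn _) (mmu n)).
move=> w; rewrite ger0_norm //; rewrite -[X in _ <= X%:R]card_ord -sumr_const.
apply: ler_sum => n _.
have /andP[h1 h2] := market_price_itv t w n; have /andP[h3 h4] := mu_itv t w n.
by rewrite -real_normK ?num_real // expr_le1 // ler_norml; have := delta_gt0; lra.
Qed.

(** * Log-wealth of agent [m1] and convergence of the prices *)

Section Drift.
Hypothesis sM : markov_wrt P F s.
Hypothesis muX : forall t n, cond_exp_version P (sigma_of (s t))
  (fun w => X (s t.+1 w) n) (fun w => mu (s t w) n).

(** The linear lower bound of [ln_growth_ge] is integrated with [mu] in place of the outcome, and
    since [mu] is the strategy of [m1], [sum_log_growth_weight] applies. The weights contain the
    wealths, which is why [markov_cond_exp] is needed. *)
Lemma ln_wealth_drift t :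
  \int[P]_w lnW t w + delta ^+ 2 / 4 * \int[P]_w price_gap t w <= \int[P]_w lnW t.+1 w.
Proof.
have Iq := integrable_price_gap t.
have IL := integrable_ln_wealth t.
pose K := 1 + delta^-1 + (delta^-1 + 1) ^+ 2.
have wK n w : `|weight t w n| <= K.
  exact: (log_growth_weight_bounded m1 delta_gt0 (nu_itv t w) (lam_sim t w)
    (lam_ge t w) (agent_wealth_gt0 t w)).
have Gw n := G_measurable_of_adapted (@measurable_weight t n).
have mw n := measurable_of_adapted (@measurable_weight t n).
have IwX : intg (fun w => \sum_(n < N) weight t w n * X (s t.+1 w) n).
  apply: integrable_big_sum => n.
  exact: integrable_bounded_mul (mw n) (wK n) (IX _ _).
have Iwmu : intg (fun w => \sum_(n < N) weight t w n * mu (s t w) n).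
  apply: integrable_big_sum => n.
  exact: integrable_bounded_mul (mw n) (wK n) (Imu _ _).
apply: (@le_trans _ _ (\int[P]_w (lnW t w + \sum_(n < N) weight t w n * X (s t.+1 w) n))).
  rewrite RintegralD // lerD2l (@Rintegral_mul_outcome (F t) t (fun n w => weight t w n) K) //.
  - rewrite -RintegralZl //; apply: le_Rintegral => //; first exact: integrable_scale.
    move=> w _.
    have := sum_log_growth_weight m1 delta_gt0 (nu_itv t w) (lam_sim t w)
      (lam_ge t w) (agent_wealth_gt0 t w) m1.
    rewrite /price_gap /weight.
    under eq_bigr do rewrite -/(market_price t w _) /lam_ lam1_mu.
    move=> /le_trans; apply; rewrite le_eqVlt; apply/orP; left; apply/eqP.
    by apply: eq_bigr => n _; rewrite -lam1_mu.
  - exact: filF.2.1.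
  - have [h0 hC _] := filF.1 t; have := hC _ h0; by rewrite setD0.
  - move=> n A FA.
    by apply: (markov_cond_exp filF sF sM (mX n) _ (mmu n) (muX t n)) => // x; exact: X01.
apply: le_Rintegral => //.
- exact: integrable_addr.
- exact: integrable_ln_wealth.
- move=> w _; rewrite /lnW ln_agent_wealthS lerD2l.
  exact: (ln_growth_ge m1 delta_gt0 (nu_itv t w) (lam_sim t w) (lam_ge t w)
    (X_simplex (s t.+1 w)) (agent_wealth_gt0 t w)).
Qed.

Lemma ae_price_gap_cvg0 : {ae P, forall w, price_gap ^~ w @ \oo --> 0}.
Proof.
pose C := \sum_(k < M) W0 k.
pose D := delta ^+ 2 / 4.
have D0 : 0 < D by rewrite divr_gt0 ?exprn_gt0.
(* The drift inequality telescopes: the log-wealth starts at [ln (W0 m1)] and never exceeds the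
   logarithm of the conserved total wealth [C]. *)
apply: (@ae_cvg0_of_summable_Rintegral _ _ _ _ _ ((ln C - ln (W0 m1)) / D)).
- exact: integrable_price_gap.
- by [].
move=> n; rewrite ler_pdivlMr // mulrC lerBrDl.
have EP r : \int[P]_w r = r.
  by rewrite Rintegral_cst // (_ : fine _ = 1) ?mulr1 //; exact: (congr1 fine (probability_setT P)).
apply: (@le_trans _ _ (\int[P]_w lnW n w)).
  elim: n => [|n IHn].
    by rewrite big_ord0 mulr0 addr0 -[leLHS]EP.
  rewrite big_ord_recr /= mulrDr addrA; have := ln_wealth_drift n.
  by rewrite -/D => h; apply: le_trans h; rewrite lerD2r.
rewrite -[leRHS]EP; apply: le_Rintegral => //.
- exact: integrable_ln_wealth.
- exact: finite_measure_integrable_cst.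
move=> w _; rewrite ler_ln ?posrE ?agent_wealth_gt0 ?agent_wealth_le //.
exact: lt_le_trans (agent_wealth_gt0 n w m1) (agent_wealth_le n w m1).
Qed.

End Drift.

(** * Decay of the wealth of a competitor *)

Section Competitor.
Variable m : 'I_M.

Let outcome_growth t w := growth (nu_ t w) (lam_ t w) (X (s t.+1 w)) (mu (s t w)) m.

Let outcome_growth_itv t w : delta <= outcome_growth t w <= delta^-1.
Proof.
exact: (growth_itv m1 delta_gt0 (nu_itv t w) (lam_sim t w) (lam_ge t w)
  (X_simplex (s t.+1 w)) m (mu_itv t w)).
Qed.

Let measurable_div_mu n : measurable_fun setT (fun x => lam m x n / mu x n).
Proof. by apply: measurable_funM => //; exact: measurableT_comp (@measurable_invr R) (mmu n). Qed.

Let measurable_growth d' (T : measurableType d') (f g : T -> S) :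
  measurable_fun setT f -> measurable_fun setT g ->
  measurable_fun setT (fun w => growth (nu ^~ (f w)) (lam ^~ (f w)) (X (g w)) (mu (f w)) m).
Proof.
move=> mf mg.
have mnuf : measurable_fun setT (fun w => nu m (f w)) by exact: measurableT_comp (mnu m) mf.
apply: measurable_funD; first by apply: measurable_funB => //; exact: measurable_cst.
apply: measurable_funM => //; apply: measurable_sum => n.
apply: measurable_funM; first exact: measurableT_comp (mX n) mg.
exact: measurableT_comp (measurable_div_mu n) mf.
Qed.

Lemma log_growth_itv t w : `|log_growth m (s t w) (s t.+1 w)| <= - ln delta.
Proof.
have /andP[h1 h2] := outcome_growth_itv t w.
have z0 := lt_le_trans delta_gt0 h1.
rewrite ler_norml opprK; apply/andP; split.
  by rewrite ler_ln.
by rewrite -lnV ?posrE // ler_ln ?posrE ?invr_gt0.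
Qed.

Lemma integrable_log_growth t : intg (fun w => log_growth m (s t w) (s t.+1 w)).
Proof.
apply: (bounded_measurable_integrable P (K := - ln delta)); last exact: log_growth_itv.
exact: measurableT_comp (@measurable_ln R) (measurable_growth (msO t) (msO t.+1)).
Qed.

Lemma Rintegral_log_growth_lt0 t :
  (forall n, cond_exp_version P (sigma_of (s t))
     (fun w => X (s t.+1 w) n) (fun w => mu (s t w) n)) ->
  (forall c : 'I_N -> Omega -> R, (forall n, G_measurable (sigma_of (s t)) (c n)) ->
     {ae P, forall w, \sum_(n < N) c n w * X (s t.+1 w) n = 0} ->
     forall n, {ae P, forall w, c n w = 0}) ->
  (0 < P [set w | exists n, lam m (s t w) n <> mu (s t w) n])%E ->
  \int[P]_w log_growth m (s t w) (s t.+1 w) < 0.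
Proof.
move=> muX indep Plam.
pose z := outcome_growth t.
(* Because the outcomes sum to one, [z - 1] is a linear combination of them with these coefficients,
   which depend on [s t] only; the independence hypothesis can thus be applied to it. *)
pose cS n x := nu m x * (lam m x n / mu x n - 1).
pose c n w := cS n (s t w).
have mcS n : measurable_fun setT (cS n).
  by apply: measurable_funM => //; apply: measurable_funB.
have Gc n : G_measurable (sigma_of (s t)) (c n).
  move=> B mB; exists (cS n @^-1` B) => //.
  by rewrite -[X in measurable X]setTI; exact: mcS.
have mu_gt0 w n : 0 < mu (s t w) n.
  by have /andP[h _] := mu_itv t w n; exact: lt_le_trans h.
have zc w : z w - 1 = \sum_(n < N) c n w * X (s t.+1 w) n.
  rewrite /z /outcome_growth /growth -addrA addrAC addrA.
  have -> : \sum_(n < N) c n w * X (s t.+1 w) n = nu m (s t w) *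
     (\sum_(n < N) X (s t.+1 w) n * (lam m (s t w) n / mu (s t w) n) - \sum_(n < N) X (s t.+1 w) n).
    by rewrite -sumrB mulr_sumr; apply: eq_bigr => n _; rewrite /c /cS; ring.
  by rewrite (X_simplex _).2 /nu_ /lam_; ring.
have z1 w : delta <= z w <= delta^-1 by exact: outcome_growth_itv.
have mz : measurable_fun setT z by exact: measurable_growth (msO t) (msO t.+1).
have d1 : 1 <= delta^-1.
  have [w _] : exists w, [set: Omega] w.
    by exists point.
  by rewrite invf_ge1 //; have /andP[h1 h2] := nu_itv t w m; exact: le_trans h2.
have Iz : intg (fun w => z w - 1).
  apply: (bounded_measurable_integrable P (K := delta^-1)).
    by apply: measurable_funB => //; exact: measurable_cst.
  by move=> w; have := z1 w; rewrite ler_norml; have := delta_gt0; lra.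
have Iz2 : intg (fun w => (z w - 1) ^+ 2).
  apply: (bounded_measurable_integrable P (K := delta^-1 ^+ 2)).
    apply: measurable_funX; apply: measurable_funB => //; exact: measurable_cst.
  move=> w; rewrite normrX lerXn2r ?nnegrE //; first by lra.
  by have := z1 w; rewrite ler_norml; have := delta_gt0; lra.
have Ez : \int[P]_w (z w - 1) = 0.
  under eq_Rintegral do rewrite zc.
  rewrite (@Rintegral_mul_outcome (sigma_of (s t)) t c (delta^-1)) //.
  - rewrite (_ : (fun w => _) = (fun=> 0)); last first.
      apply/funext => w; transitivity (nu m (s t w) *
         (\sum_(n < N) lam m (s t w) n - \sum_(n < N) lam m1 (s t w) n)).
        rewrite -sumrB mulr_sumr; apply: eq_bigr => n _; rewrite /c /cS lam1_mu.
        by field; rewrite gt_eqF.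
      by rewrite (lam_simplex m _).2 (lam_simplex m1 _).2 subrr mulr0.
    by rewrite Rintegral_cst // mul0r.
  - by move=> A [B mB <-]; apply: (filF.2.1 t); exact: sF.
  - by exists setT => //; rewrite preimage_setT.
  - by move=> n A GA; rewrite (cond_exp_version_Rintegral (muX n) GA).
  - move=> n w; rewrite /c /cS normrM -[leRHS]mul1r ler_pM //.
      have /andP[h1 h2] := nu_itv t w m.
      by rewrite ger0_norm // (le_trans (ltW delta_gt0)).
    have l0 : 0 <= lam m (s t w) n / mu (s t w) n.
      by rewrite divr_ge0 ?(ltW (mu_gt0 _ _)) // (lam_simplex m _).1.
    have l1 : lam m (s t w) n / mu (s t w) n <= delta^-1.
      rewrite -[leRHS]mul1r ler_pM ?(lam_simplex m _).1 ?invr_ge0 ?(ltW (mu_gt0 _ _)) //.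
        have [g0 <-] := lam_simplex m (s t w).
        by rewrite (bigD1 n) //= lerDl; apply: sumr_ge0 => i _; exact: g0.
      by rewrite lef_pV2 ?posrE //; have /andP[] := mu_itv t w n.
    by rewrite ler_norml; lra.
(* If the mean were nonnegative, the quadratic bound on [ln z] together with the zero mean of
   [z - 1] would force [z = 1] almost surely. Then all coefficients [c n] vanish, and [lam m] agrees
   with [mu] almost surely because [nu m] is positive. *)
rewrite ltNge; apply/negP => E0.
have Ele : \int[P]_w log_growth m (s t w) (s t.+1 w) <=
    \int[P]_w ((z w - 1) - (4 * delta^-1)^-1 * (z w - 1) ^+ 2).
  apply: le_Rintegral => //; first exact: integrable_log_growth.
    by apply: integrable_subr => //; exact: integrable_scale.
  move=> w _; rewrite [_^-1 * _]mulrC; apply: ln_le_quadratic => //.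
  by have /andP[h ->] := z1 w; rewrite (lt_le_trans delta_gt0 h).
rewrite RintegralB // in Ele; last exact: integrable_scale.
rewrite Ez sub0r RintegralZl // in Ele.
have Ez2 : \int[P]_w (z w - 1) ^+ 2 = 0.
  apply/le_anti; rewrite Rintegral_ge0 ?andbT; last by move=> w _; exact: sqr_ge0.
  have K0 : 0 < (4 * delta^-1)^-1 by rewrite invr_gt0 mulr_gt0 // invr_gt0.
  rewrite -(pmulr_rle0 _ K0); lra.
have aez : {ae P, forall w, z w - 1 = 0}.
  have mz2 : measurable_fun setT (fun w => ((z w - 1) ^+ 2)%:E) by case/integrableP: Iz2.
  have h := ae_eq_integral_abs P measurableT mz2.
  have : (\int[P]_w `|((z w - 1) ^+ 2)%:E| = 0)%E.
    under eq_integral do rewrite gee0_abs ?lee_fin ?sqr_ge0 //.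
    by rewrite -[LHS]fineK ?[fine _]Ez2 //; exact: integrable_fin_num Iz2.
  move=> /h; apply: filterS => w /(_ I) [/eqP].
  by rewrite sqrf_eq0 => /eqP.
have aec n : {ae P, forall w, c n w = 0}.
  by apply: (indep c Gc _ n); apply: filterS aez => w; rewrite zc.
have aelam : {ae P, forall w, forall n, lam m (s t w) n = mu (s t w) n}.
  have aec' : {ae P, forall w, forall n, c n w = 0} by exact: filter_forall.
  apply: filterS aec' => w h n.
  have /eqP := h n; rewrite /c /cS mulf_eq0 => /orP[/eqP nu0|].
    by have /andP[] := nu_itv t w m; rewrite /nu_ nu0 leNgt delta_gt0.
  rewrite subr_eq0 => /eqP h1.
  by rewrite -[RHS]mul1r -h1 divfK // gt_eqF.
have [A [mA PA0 subA]] := aelam.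
have : (P [set w | exists n, lam m (s t w) n <> mu (s t w) n] <= P A)%E.
  apply: le_measure; rewrite ?inE //.
    rewrite (_ : [set w | _] = \bigcup_(n in [set: 'I_N])
        ((fun w => lam m (s t w) n - mu (s t w) n) @^-1` (~` [set 0]))); last first.
      apply/seteqP; split => w /=.
        by move=> [n h]; exists n => //= /eqP; rewrite subr_eq0 => /eqP.
      by move=> [n _ /= h]; exists n => e; apply: h; rewrite e subrr.
    apply: fin_bigcup_measurable; first exact: finite_finset.
    move=> n _; rewrite -[X in measurable X]setTI.
    suff h : measurable_fun setT (fun w => lam m (s t w) n - mu (s t w) n).
      by apply: h => //; exact: measurableC.
    by apply: measurable_funB;
      [exact: measurableT_comp (mlam m n) (msO t)|exact: measurableT_comp (mmu n) (msO t)].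
  by move=> w [n h]; apply: subA => /= h'; exact: h.
by rewrite PA0 leNgt Plam.
Qed.

Lemma agent_wealth_cvg0 :
  markov_wrt P F s -> stationary P s -> ergodic P s ->
  (forall t n, cond_exp_version P (sigma_of (s t))
     (fun w => X (s t.+1 w) n) (fun w => mu (s t w) n)) ->
  \int[P]_w log_growth m (s 0 w) (s 1 w) < 0 ->
  {ae P, forall w, (fun t => agent_wealth t w m) @ \oo --> 0}.
Proof.
move=> sM sP sE muX Elt0.
(* The mean is [-4 * b]. Adding [2 * b] to each term keeps it negative, and boundedness of the
   shifted sums is then the slope condition of [expR_cvg0_of_drift]. *)
pose b := - (\int[P]_w log_growth m (s 0 w) (s 1 w)) / 4.
have b0 : 0 < b by rewrite divr_gt0 // oppr_gt0.
pose B := - ln delta.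
(* The bounds by [delta] hold only along the trajectories of [s]. Clamping to [[-B, B]] makes [g]
   bounded on all paths and changes nothing on those trajectories. *)
pose g (x : path_space S) : R :=
  Num.max (- B) (Num.min B (log_growth m (x 0%N) (x 1%N))) + 2 * b.
have B0 : 0 <= B by exact: le_trans (normr_ge0 _) (log_growth_itv 0 point).
have gs t w : g (fun i => s (t + i)%N w) = log_growth m (s t w) (s t.+1 w) + 2 * b.
  have := log_growth_itv t w; rewrite ler_norml -/B => /andP[h1 h2].
  by rewrite /g addn0 addn1 (min_idPr h2) (max_idPr h1).
have mg : measurable_fun setT g.
  apply: measurable_funD => //.
  apply: measurable_maxr; first exact: measurable_cst.
  apply: measurable_minr; first exact: measurable_cst.
  exact: measurableT_comp (@measurable_ln R)
    (measurable_growth (@measurable_coordinate _ S 0) (@measurable_coordinate _ S 1)).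
have gB x : `|g x| <= B + 2 * b.
  apply: (le_trans (ler_normD _ _)); apply: lerD; last by rewrite ger0_norm // mulr_ge0 // ltW.
  by rewrite ler_norml le_max lexx ge_max ge_min lexx /= andbT; lra.
have Eg : (\int[P]_w (g (s ^~ w))%:E < 0)%E.
  have E1 : \int[P]_w (log_growth m (s 0 w) (s 1 w) + 2 * b) < 0.
    rewrite RintegralD //; [|exact: integrable_log_growth|exact: finite_measure_integrable_cst].
    rewrite Rintegral_cst // (_ : fine _ = 1); last exact: (congr1 fine (probability_setT P)).
    by rewrite /b; lra.
  have I1 : intg (fun w => log_growth m (s 0 w) (s 1 w) + 2 * b).
    apply: integrable_addr; first exact: integrable_log_growth.
    exact: finite_measure_integrable_cst.
  under eq_integral do rewrite (gs 0).
  by rewrite -[X in (X < _)%E]fineK ?lte_fin //; exact: integrable_fin_num I1.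
have bnd := ergodic_sums_bounded_above msO sP mg gB sE Eg.
have gap := ae_price_gap_cvg0 sM muX.
apply: filterS2 bnd gap => w [K hK] gap0.
pose Sg t := \sum_(k < t) log_growth m (s k w) (s k.+1 w).
pose r t := delta ^- 3 * \sum_(n < N) `|market_price t w n - mu (s t w) n|.
have -> : (fun t => agent_wealth t w m) = (fun t => expR (ln (agent_wealth t w m))).
  by apply/funext => t; rewrite lnK // posrE agent_wealth_gt0.
apply: (@expR_cvg0_of_drift _ _ Sg r K b) => //.
- move=> t; have -> : Sg t.+1 - Sg t = log_growth m (s t w) (s t.+1 w).
    by rewrite /Sg big_ord_recr /= addrAC subrr add0r.
  rewrite ln_agent_wealthS -addrA lerD2l -lerBlDl.
  exact: (ln_growth_price_le m1 delta_gt0 (nu_itv t w) (lam_sim t w) (lam_ge t w)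
    (X_simplex (s t.+1 w)) (agent_wealth_gt0 t w) m (mu_itv t w)).
- move=> t; apply: le_trans (hK t); rewrite /ergodic_sum.
  under eq_bigr do rewrite gs.
  by rewrite big_split /= sumr_const card_ord lerD2l (mulr_natr (2 * b)).
have sq0 : (fun t => delta ^- 3 * (N%:R * Num.sqrt (price_gap t w))) @ \oo --> 0.
  rewrite -[X in _ --> X](mulr0 (delta ^- 3)); apply: cvgM; first exact: cvg_cst.
  rewrite -[X in _ --> X](mulr0 N%:R); apply: cvgM; first exact: cvg_cst.
  rewrite -[X in _ --> X]sqrtr0.
  exact: continuous_cvg (@sqrt_continuous R 0) gap0.
have rle : \forall t \near \oo,
    (0 : R) <= r t <= delta ^- 3 * (N%:R * Num.sqrt (price_gap t w)).
  apply: nearW => t.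
  rewrite mulr_ge0 ?invr_ge0 ?exprn_ge0 ?(ltW delta_gt0) ?sumr_ge0 //=.
  rewrite ler_wpM2l ?invr_ge0 ?exprn_ge0 ?(ltW delta_gt0) //.
  rewrite -[X in X%:R * _]card_ord mulr_natl -sumr_const; apply: ler_sum => n _.
  rewrite -sqrtr_sqr ler_sqrt // /price_gap (bigD1 n) //= lerDl.
  by apply: sumr_ge0 => i _; exact: sqr_ge0.
exact: squeeze_cvgr rle _ (cvg_cst 0) sq0.
Qed.

End Competitor.
End PredictionMarket.

Theorem theorem2 (R : realType) (d : measure_display) (Omega : measurableType d)
  (P : probability Omega R) (F : nat -> set (set Omega))
  (dS : measure_display) (S : measurableType dS) (s : nat -> Omega -> S)
  (N M : nat) (X : S -> 'I_N -> R) (mu : S -> 'I_N -> R)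
  (W0 : 'I_M -> R) (nu : 'I_M -> S -> R) (lam : 'I_M -> S -> 'I_N -> R)
  (m1 : 'I_M) (eps : R) :
  is_filtration F ->
  (forall t (B : set S), measurable B -> F t (s t @^-1` B)) ->
  markov_wrt P F s -> stationary P s -> ergodic P s ->
  (forall n, measurable_fun setT (fun x => X x n)) ->
  (forall x, in_simplex (X x)) ->
  0 < eps ->
  (forall t n, exists Y, cond_exp_version P (F t) (fun w => X (s t.+1 w) n) Y /\
                         {ae P, forall w, eps <= Y w}) ->
  (forall t (c : 'I_N -> Omega -> R),
     (forall n, G_measurable (sigma_of (s t)) (c n)) ->
     {ae P, forall w, \sum_(n < N) c n w * X (s t.+1 w) n = 0} ->
     forall n, {ae P, forall w, c n w = 0}) ->
  (forall n, measurable_fun setT (fun x => mu x n)) ->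
  (forall t n, cond_exp_version P (sigma_of (s t))
                 (fun w => X (s t.+1 w) n) (fun w => mu (s t w) n)) ->
  (forall m, 0 < W0 m) ->
  (forall m, measurable_fun setT (nu m)) ->
  (forall m n, measurable_fun setT (fun x => lam m x n)) ->
  (forall m x, 0 <= nu m x <= 1) ->
  (forall m x, in_simplex (lam m x)) ->
  (exists2 delta : R, 0 < delta & forall m t w,
     delta <= nu m (s t w) /\ forall n, delta <= lam m (s t w) n) ->
  (forall x n, lam m1 x n = mu x n) ->
  forall m : 'I_M,
    (exists t, (0 < P [set w | exists n, lam m (s t w) n <> mu (s t w) n])%E) ->
    {ae P, forall w,
       (fun t => wealth W0 (fun t k => nu k (s t w)) (fun t k n => lam k (s t w) n)
                   (fun t n => X (s t w) n) t m) @ \oo --> 0}.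
Proof.
move=> filF sF sM sP sE mX Xsim _ _ indep mmu muX W0_gt0 mnu mlam nu01 lamsim.
move=> [delta delta_gt0 delta_le] lam1 m [t lamNmu].
have ms u : measurable_fun setT (s u).
  by move=> _ B mB; rewrite setTI; apply: (filF.2.1 u); exact: sF.
(* Stationarity, applied to a box with a single coordinate, moves the event from time [t] to time 0,
   where the ergodic sums start. *)
have lamNmu0 : (0 < P [set w | exists n, lam m (s 0%N w) n <> mu (s 0%N w) n])%E.
  pose D : set S := [set x | exists n, lam m x n <> mu x n].
  have mD : measurable D.
    rewrite (_ : D = \bigcup_(n in [set: 'I_N]) ((fun x => lam m x n - mu x n) @^-1` (~` [set 0]))).
      apply: fin_bigcup_measurable; first exact: finite_finset.
      move=> n _; rewrite -[X in measurable X]setTI.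
      by apply: (measurable_funB (mlam m n) (mmu n)) => //; exact: measurableC.
    apply/seteqP; split => x /=.
      by move=> [n h]; exists n => //= /eqP; rewrite subr_eq0 => /eqP.
    by move=> [n _ /= h]; exists n => e; apply: h; rewrite e subrr.
  have := sP 0%N t (fun=> D) (fun=> mD).
  have E u : [set w | forall i, (i <= 0)%N -> D (s (u + i)%N w)] = [set w | D (s u w)].
    apply/seteqP; split => w /=; first by move=> /(_ 0%N isT); rewrite addn0.
    by move=> h i; rewrite leqn0 => /eqP ->; rewrite addn0.
  rewrite E; have := E 0%N; rewrite /= => -> <-.
  exact: lamNmu.
have neg := Rintegral_log_growth_lt0 filF sF mX Xsim mmu mnu mlam nu01 lamsim
  delta_gt0 delta_le lam1 (muX 0%N) (indep 0%N) lamNmu0.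
exact: (agent_wealth_cvg0 filF sF mX Xsim mmu W0_gt0 mnu mlam nu01 lamsim
  delta_gt0 delta_le lam1 sM sP sE muX neg).
Qed.
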